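(* Let $1<p,q,r<\infty$ with $p\le q$. Then there is a constant $C>0$, depending only on $n,p,q,r$, such that for every cube $Q\in\mathcal{Q}(\mathbb{R}^n)$, every pair of weights $(w,v)\in\mathcal{A}^{r,r}_{p,q}(Q)$ and every $f\in Lip(Q)$, $$\|v(f-f_Q)\|_{L^q(Q)}\le C\,[w,v]_{\mathcal{A}^{r,r}_{p,q}(Q)}\,\bigl\|w|\nabla f|\bigr\|_{L^p(Q)}.$$
   Context: $\mathcal{Q}(\mathbb{R}^n)$ is the collection of all cubes in $\mathbb{R}^n$ with sides parallel to the coordinate axes; $\ell_Q$ is the side length of $Q$. $\mathcal{D}(Q)$ is the collection of all cubes obtained from $Q$ by finitely many (possibly zero) bisections, i.e. the dyadic subcubes of $Q$, including $Q$ itself. $f_Q=\frac{1}{|Q|}\int_Q f(x)\,dx$, also written with an averaged integral: $⨍_R h:=\frac1{|R|}\int_R h(x)\,dx$. $Lip(Q)$ is the family of all Lipschitz continuous functions on $Q$. A weight on $E\subset\mathbb{R}^n$ is a function $w\in L^1_{\rm loc}(E)$ (integrable on every compact subset of $E$) with $w(x)>0$ and $w(x)^{-1}>0$ for a.e. $x\in E$. $p'=p/(p-1)$. For $1<p<\infty$, $0<q<\infty$, $1\le r,\tilde r<\infty$, $\mathcal{A}^{r,\tilde r}_{p,q}(Q)$ is the family of all pairs $(w,v)$ of weights on $Q$ with $$[w,v]_{\mathcal{A}^{r,\tilde r}_{p,q}(Q)}:=\sup_{R\in\mathcal{D}(Q)}\frac{\ell_R}{|R|^{\frac1p-\frac1q}}\left(\frac1{|R|}\int_R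 w(x)^{-p'r}\,dx\right)^{\frac1{p'r}}\left(\frac1{|R|}\int_R v(x)^{q\tilde r}\,dx\right)^{\frac1{q\tilde r}}<\infty.$$ *)

(* Defs.v *)
(* R^n is 'rV[R]_n for an arbitrary R : realType. *)
From HB Require Import structures.
From mathcomp Require Import all_boot all_order all_algebra.
From mathcomp Require Import all_classical all_reals all_analysis.
Set Implicit Arguments.
Unset Strict Implicit.
Unset Printing Implicit Defensive.
Import Order.TTheory GRing.Theory Num.Theory.
Import numFieldNormedType.Exports.
Local Open Scope classical_set_scope.
Local Open Scope ring_scope.

(** The library has no n-dimensional Lebesgue measure.  It is obtained here as
    the completion of the n-fold product of the one-dimensional one: first a
    sigma-finite measure on the sigma-algebra generated by the coordinates,
    then its Caratheodory completion [lebesgue_rV], whose measurable sets are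
    exactly the Lebesgue measurable sets. *)

Section measurable_rV.
Context {R : realType} {n : nat}.

Let coord (i : 'I_n) (x : 'rV[R]_n) : measurableTypeR R := x ord0 i.

Let rV_set0 : g_sigma_preimage coord set0.
Proof. exact: sigma_algebra0. Qed.

Let rV_setC A : g_sigma_preimage coord A -> g_sigma_preimage coord (~` A).
Proof. exact: sigma_algebraC. Qed.

Let rV_bigcup (F : _^nat) : (forall i, g_sigma_preimage coord (F i)) ->
  g_sigma_preimage coord (\bigcup_i (F i)).
Proof. exact: sigma_algebra_bigcup. Qed.

HB.instance Definition _ :=
  @isMeasurable.Build (measure_tuple_display default_measure_display)
    'rV[R]_n (g_sigma_preimage coord) rV_set0 rV_setC rV_bigcup.

End measurable_rV.

Lemma measurable_fun_rVP d (T : measurableType d) (R : realType) n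
    (f : T -> 'rV[R]_n) :
  (forall i, measurable_fun setT (fun x => f x ord0 i : measurableTypeR R)) ->
  measurable_fun setT f.
Proof.
move=> mf _ A mA; rewrite setTI.
suff : g_sigma_preimage (fun i x => f x ord0 i : measurableTypeR R)
    `<=` measurable.
  apply; rewrite (g_sigma_preimage_comp
    (fun i (x : 'rV[R]_n) => x ord0 i : measurableTypeR R) f).
  by exists A => //; rewrite setTI.
apply: smallest_sub; first exact: sigma_algebra_measurable.
move=> {A mA}; case: n => [|n] in f mf *; first by rewrite big_ord0.
rewrite -bigcup_mkord_ord; apply: bigcup_sub => i Ii A [B mB <-].
exact: mf.
Qed.

Lemma measurable_coord (R : realType) n (i : 'I_n) :
  measurable_fun [set: 'rV[R]_n] (fun x => x ord0 i : measurableTypeR R).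
Proof.
move=> _ Y mY; rewrite setTI; apply: sub_sigma_algebra => /=.
rewrite -bigcup_seq/=; exists i => /=; first by rewrite mem_index_enum.
by exists Y => //; rewrite setTI.
Qed.

Section consrV.
Context {R : realType} {n : nat}.

Definition consrV (z : measurableTypeR R * 'rV[R]_n) : 'rV[R]_n.+1 :=
  row_mx (z.1)%:M z.2.

Definition unconsrV (x : 'rV[R]_n.+1) : measurableTypeR R * 'rV[R]_n :=
  (x ord0 ord0, \row_i x ord0 (lift ord0 i)).

Lemma consrV0 z : consrV z ord0 ord0 = z.1.
Proof.
have -> : @ord0 n = lshift n (@ord0 0) by exact/val_inj.
by apply: etrans (row_mxEl _ _ _ _) _; rewrite mxE.
Qed.

Lemma consrVS z i : consrV z ord0 (lift ord0 i) = z.2 ord0 i.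
Proof.
have -> : lift ord0 i = rshift 1 i by exact/val_inj.
exact: row_mxEr.
Qed.

Lemma consrVK : cancel consrV unconsrV.
Proof.
move=> [x y]; rewrite /unconsrV consrV0; congr pair.
by apply/rowP => i; rewrite mxE consrVS.
Qed.

Lemma measurable_consrV : measurable_fun setT consrV.
Proof.
apply: measurable_fun_rVP => i; case: (unliftP ord0 i) => [j ->|->].
  under eq_fun do rewrite consrVS.
  exact: (measurableT_comp (measurable_coord j) measurable_snd).
under eq_fun do rewrite consrV0.
exact: measurable_fst.
Qed.

Lemma measurable_unconsrV : measurable_fun setT unconsrV.
Proof.
apply/measurable_fun_pairP; split; first exact: measurable_coord.
apply: measurable_fun_rVP => i /=.
under eq_fun do rewrite mxE.
exact: measurable_coord.
Qed.

Variable mu : {sigma_finite_measure set 'rV[R]_n -> \bar R}.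

Definition lebesgue_cons : set 'rV[R]_n.+1 -> \bar R :=
  pushforward (@lebesgue_measure R \x mu)%E consrV.

Let preconsrV A : measurable A -> measurable (consrV @^-1` A).
Proof. by move=> mA; rewrite -[X in measurable X]setTI; exact: measurable_consrV. Qed.

Let lebesgue_cons0 : lebesgue_cons set0 = 0%E.
Proof. by rewrite /lebesgue_cons /pushforward preimage_set0 measure0. Qed.

Let lebesgue_cons_ge0 A : (0 <= lebesgue_cons A)%E.
Proof. by rewrite /lebesgue_cons /pushforward; exact: measure_ge0. Qed.

Let lebesgue_cons_sigma_additive : semi_sigma_additive lebesgue_cons.
Proof.
move=> F mF tF mUF; rewrite /lebesgue_cons /pushforward preimage_bigcup.
apply: measure_semi_sigma_additive => [k||]; first exact: preconsrV.
- apply/trivIsetP => /= i j _ _ ij; rewrite -preimage_setI.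
  by move/trivIsetP : tF => /(_ _ _ _ _ ij) ->//; rewrite preimage_set0.
- by rewrite -preimage_bigcup; exact: preconsrV.
Qed.

HB.instance Definition _ := isMeasure.Build _ _ _ lebesgue_cons
  lebesgue_cons0 lebesgue_cons_ge0 lebesgue_cons_sigma_additive.

Let lebesgue_cons_sigma_finite : sigma_finite setT lebesgue_cons.
Proof.
have /sigma_finiteP[F [TF ndF Foo]] := sigma_finiteT (@lebesgue_measure R).
have /sigma_finiteP[G [TG ndG Goo]] := sigma_finiteT mu.
exists (fun k => unconsrV @^-1` (F k `*` G k)).
  rewrite -preimage_bigcup [X in _ @^-1` X](_ : _ = setT) ?preimage_setT//.
  rewrite -setXTT TF TG predeqE => -[x y]; split.
    by move=> [k _ []/= ? ?]; split; exists k.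
  move=> [/= [k _ Fkx] [m _ Gmy]]; exists (maxn k m) => //; split.
  - by move: x Fkx; exact/subsetPset/ndF/leq_maxl.
  - by move: y Gmy; exact/subsetPset/ndG/leq_maxr.
move=> k; have [mFk Fkoo] := Foo k; have [mGk Gkoo] := Goo k; split.
  rewrite -[X in measurable X]setTI; apply: measurable_unconsrV => //.
  exact: measurableX.
rewrite /lebesgue_cons /pushforward -comp_preimage.
rewrite (_ : unconsrV \o consrV = id); last by apply/funext=> z; exact: consrVK.
by rewrite preimage_id product_measure1E// lte_mul_pinfty// ge0_fin_numE.
Qed.

HB.instance Definition _ := Measure_isSigmaFinite.Build _ _ _ lebesgue_cons
  lebesgue_cons_sigma_finite.

End consrV.

(** For [n = 0] the unit mass of the one-point space. *)
Fixpoint product_lebesgue (R : realType) n :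
    {sigma_finite_measure set 'rV[R]_n -> \bar R} :=
  if n is n'.+1 then lebesgue_cons (product_lebesgue R n')
  else dirac (0 : 'rV[R]_0).

Definition lebesgue_rV (R : realType) (n : nat) :=
  @completed_measure_extension _ _ _ (product_lebesgue R n).
Arguments lebesgue_rV R n : clear implicits.

HB.instance Definition _ (R : realType) (n : nat) :=
  Measure.on (lebesgue_rV R n).

Lemma lebesgue_rV_sigma_finite (R : realType) (n : nat) :
  sigma_finite setT (lebesgue_rV R n).
Proof.
exact/completed_measure_extension_sigma_finite/(sigma_finiteT (product_lebesgue R n)).
Qed.

HB.instance Definition _ (R : realType) (n : nat) :=
  @Measure_isSigmaFinite.Build _ _ _ (lebesgue_rV R n)
    (lebesgue_rV_sigma_finite R n).

Record cube (R : realType) (n : nat) := Cube {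
  corner : 'rV[R]_n;
  side : R;
  side_gt0 : 0 < side }.

(** Cubes are closed, with side length [side Q > 0]. *)
Definition cube_set (R : realType) (n : nat) (Q : cube R n) : set 'rV[R]_n :=
  [set x | forall i,
    corner Q ord0 i <= x ord0 i <= corner Q ord0 i + side Q].
Coercion cube_set : cube >-> set.

Lemma half_side_gt0 (R : realType) (n : nat) (Q : cube R n) : 0 < side Q / 2.
Proof. by rewrite divr_gt0// side_gt0. Qed.

(** One of the [2 ^ n] cubes obtained by bisecting all the sides of [Q];
    [e i] selects the upper half in the [i]-th coordinate. *)
Definition child (R : realType) (n : nat) (Q : cube R n) (e : 'I_n -> bool) :=
  Cube (corner Q + \row_i ((side Q / 2) *+ e i)) (half_side_gt0 Q).

Inductive dyadic (R : realType) (n : nat) (Q : cube R n) : set (cube R n) :=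
| dyadic_refl : dyadic Q Q
| dyadic_child P e : dyadic Q P -> dyadic Q (child P e).

Section notions.
Context {R : realType} {n : nat}.
Local Notation Rn := 'rV[R]_n.
Local Notation mu := (lebesgue_rV R n).
Implicit Types (Q P : cube R n) (E : set Rn) (f w v : Rn -> R).

Definition vol E : R := fine (mu E).

Definition avg E (h : Rn -> \bar R) : \bar R :=
  ((vol E)^-1)%:E * \int[mu]_(x in E) h x.

Definition Lnorm_on E (p : R) (g : Rn -> R) : \bar R :=
  'N[mu]_p%:E[(EFin \o g) \_ E].

(** Only used almost everywhere: the partial derivatives of a function that is
    Lipschitz on a cube exist at almost every point of it, and 'D has an
    irrelevant default value at the other points. *)
Definition grad f (x : Rn) : Rn := \row_(i < n) 'D_(delta_mx ord0 i) f x.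

(** The norm [`|x|] of 'rV[R]_n is the sup norm, hence this definition. *)
Definition enorm (x : Rn) : R := Num.sqrt (\sum_(i < n) x ord0 i ^+ 2).

(** Functions on a set [E] are total functions whose values outside [E] play
    no role. *)
Definition is_weight E w : Prop :=
  (forall K : set Rn, compact K -> K `<=` E ->
     mu.-integrable K (EFin \o w)) /\
  {ae mu, forall x, E x -> 0 < w x /\ 0 < (w x)^-1}.

Definition conj_exp (p : R) : R := p / (p - 1).

Definition A_char (p q r s : R) Q w v : \bar R :=
  ereal_sup [set
    (side P / vol P `^ (p^-1 - q^-1))%:E
    * avg P (fun x => (w x `^ (- (conj_exp p * r)))%:E)
        `^ ((conj_exp p * r)^-1)
    * avg P (fun x => (v x `^ (q * s))%:E) `^ ((q * s)^-1)
  | P in dyadic Q]%E.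

Definition A_class (p q r s : R) Q w v : Prop :=
  [/\ is_weight Q w, is_weight Q v & (A_char p q r s Q w v < +oo)%E].

End notions.

(* Main.v *)
Require Import Defs.
From HB Require Import structures.
From mathcomp Require Import all_boot all_order all_algebra.
From mathcomp Require Import all_classical all_reals all_analysis.
From mathcomp Require Import measurable_realfun.
From mathcomp Require Import ring lra.
Import Order.TTheory GRing.Theory Num.Theory.
Import numFieldNormedType.Exports.
Local Open Scope classical_set_scope.
Local Open Scope ring_scope.

(** The oscillation of [f] is expanded over the dyadic subcubes of [Q], and the
    resulting sum is a bilinear form on the dyadic tree that the weights control.

    From the oscillation to a sum over the tree.  When [F] is Lipschitz, the
    averages of [F] over a cube [P] and over one of its children differ by at most
    a constant times [side P] times the mean of [|grad F|] over [P]
    ([child_average_le]).  Indeed two adjacent children are translates of each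
    other, the difference of their averages is a mean of increments of [F] along
    segments parallel to an axis, an increment is at most the integral of the
    partial derivative along its segment, and Tonelli's theorem together with
    translation invariance turns the double integral into an integral over [P].
    Telescoping over [k] generations, and integrating against [u >= 0], bounds the
    integral of [`|F - F_Q| * u] by a constant times the sum over [P] of
    [side P * (mean of |grad F| over P) * (integral of u over P)], up to a
    remainder of order [2 ^- k] ([oscillation_tree_sum]).  With [u = v h] and
    [h = (v `|F - F_Q|) `^ (q - 1)] the left-hand side is the [q]-th power of the
    norm to be estimated, so that by duality it remains to bound the sum by the
    characteristic times the L^p norm of [w |grad F|] times the L^q' norm of [h]
    ([weighted_poincare]).

    The bound of the sum.  On one cube, Hölder's inequality with the exponents
    [p' r] for the inverse of [w] and [q r] for [v] brings in exactly the two means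
    of the characteristic ([hoelder_key]); the means that are left over are those of
    [(w |grad F|) `^ s] and [h `^ t], where [s] and [t] are conjugate to [p' r] and
    [q r].  Since [r > 1], [s < p] and [t < q'], and the Carleson embedding theorem
    would apply if the cubes satisfied a packing condition.  As the sides halve at
    each generation, the sum may be restricted to such a family, in a smooth form:
    if [m] is the largest mean of [|grad F|] over [P] and its ancestors, and [mu] the
    same without [P] itself, then giving to [P] the weight [theta = (m - mu) / m]
    costs a factor 2 only, by summation by parts along the branches
    ([tree_sum_record_sum]).  These weights satisfy the Carleson condition in the
    form of a potential, [theta + (mean over P) / m], whose mean over the children of
    [P] is smaller by at least [theta] ([record_density_child]).  The embedding
    ([record_embedding]) is then a Bellman function argument based on the convexity of
    [x `^ P / M `^ (P - 1)] ([powR_perspective_tangent]).  The bilinear form splits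
    into two embeddings by Young's inequality after normalisation, and this is where
    [p <= q] enters, in the form [q' <= p'] ([tree_bilinear]).

    Differentiability.  A function that is Lipschitz on [Q] extends to a bounded
    Lipschitz function on the whole space through the projection onto [Q]
    ([lipschitz_extension]).  In one variable an affine change makes a Lipschitz
    function into a [G] such that [G] and [id - G] are nondecreasing; the Stieltjes
    measure of [G] is then dominated by the Lebesgue measure, its density is
    integrable, and Lebesgue's differentiation theorem identifies the density with
    the derivative almost everywhere ([lipschitz_FTC]).  In several variables the
    points without a given partial derivative form a Borel set that is null on each
    line parallel to the axis, hence null by Tonelli's theorem ([slices_null],
    [nonderivable_null]). *)

(** * Embedding inequalities on trees *)

Section tangent.
Context {R : realType}.
Implicit Types P x M tau : R.

Lemma powR_inv x a : 0 <= x -> x^-1 `^ a = (x `^ a)^-1 :> R.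
Proof. by move=> x0; rewrite -powR_inv1// powRAC powR_inv1 ?powR_ge0. Qed.

Lemma powR_div x y a : 0 <= x -> 0 <= y -> (x / y) `^ a = x `^ a / y `^ a :> R.
Proof. by move=> x0 y0; rewrite powRM ?invr_ge0// powR_inv. Qed.

(** The function [x `^ P / M `^ (P - 1)] of [x] and [M] is convex and homogeneous
    of degree one.  The left-hand side is its tangent plane along the ray
    [x / M = tau]; dividing by [M], the claim is Young's inequality for [x / M] and
    [tau `^ (P - 1)]. *)
Lemma powR_perspective_tangent P x M tau : 1 < P -> 0 <= x -> 0 < M -> 0 <= tau ->
  P * x * tau `^ (P - 1) - (P - 1) * M * tau `^ P <= x `^ P / M `^ (P - 1).
Proof.
move=> P1 x0 M0 t0.
have P0 : 0 < P by rewrite (lt_trans _ P1).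
have Q0 : 0 < P / (P - 1) by rewrite divr_gt0 ?subr_gt0.
have xM : 0 <= x / M by rewrite divr_ge0// ltW.
have conj1 : P^-1 + (P / (P - 1))^-1 = 1.
  by field; rewrite subr_eq0 !gt_eqF.
have := conjugate_powR xM (powR_ge0 tau (P - 1)) P0 Q0 conj1.
rewrite -powRrM mulrCA divff ?mulr1 ?subr_eq0 ?gt_eqF// invf_div.
rewrite -(ler_pM2l (mulr_gt0 P0 M0)).
have -> : P * M * (x / M * tau `^ (P - 1)) = P * x * tau `^ (P - 1).
  by field; rewrite gt_eqF.
have -> : P * M * ((x / M) `^ P / P + tau `^ P * ((P - 1) / P)) =
    M * (x / M) `^ P + (P - 1) * M * tau `^ P by field; rewrite gt_eqF.
have -> : M * (x / M) `^ P = x `^ P / M `^ (P - 1).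
  rewrite powR_div ?(ltW M0)// powRB ?powRr1 ?ltW//; last by rewrite (gt_eqF M0) implybT.
  by field; rewrite !gt_eqF// powR_gt0.
by rewrite lerBlDr.
Qed.

End tangent.

Section trees.
Context {R : realType} {T : Type} {I : finType}.
Variables (ch : T -> I -> T).
Implicit Types (m Phi Psi : T -> R) (mu : R).

Definition additive_mass m :=
  (forall x, 0 <= m x) /\ (forall x, m x = \sum_i m (ch x i)).

Fixpoint tree_sum k Phi x : R :=
  if k is k'.+1 then Phi x + \sum_i tree_sum k' Phi (ch x i) else 0.

(** Here [mu] is the largest value of [a] among the strict ancestors; a node counts
    in proportion to the amount by which it beats this record, relatively to the new
    record.  This is a smooth substitute for retaining only the nodes at which
    [a] has doubled since the last node retained. *)
Fixpoint record_sum (a : T -> R) k (mu : R) Phi x : R :=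
  if k is k'.+1 then
    (Num.max mu (a x) - mu) / Num.max mu (a x) * Phi x +
    \sum_i record_sum a k' (Num.max mu (a x)) Phi (ch x i)
  else 0.

Lemma additive_mass_child m x i : additive_mass m -> m (ch x i) <= m x.
Proof. by move=> [m0 mE]; rewrite (mE x) (bigD1 i)//= lerDl sumr_ge0. Qed.

Lemma record_sum_le (D : T -> Prop) a k mu Phi Psi x :
  (forall x i, D x -> D (ch x i)) -> (forall x, D x -> Phi x <= Psi x) ->
  0 <= mu -> D x -> record_sum a k mu Phi x <= record_sum a k mu Psi x.
Proof.
move=> Dch le; elim: k mu x => [//|k IH] mu x mu0 Dx /=.
have m0 : 0 <= Num.max mu (a x) by rewrite le_max mu0.
apply: lerD; last by apply: ler_sum => i _; apply: IH => //; exact: Dch.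
by rewrite ler_wpM2l ?le// divr_ge0// subr_ge0 le_max lexx.
Qed.

Lemma record_sumD a k mu Phi Psi x :
  record_sum a k mu (fun x => Phi x + Psi x) x =
  record_sum a k mu Phi x + record_sum a k mu Psi x.
Proof.
elim: k mu x => [|k IH] mu x /=; first by rewrite addr0.
rewrite mulrDr addrACA -big_split/=; congr (_ + _).
by apply: eq_bigr => i _; rewrite IH.
Qed.

Lemma record_sumZ a k mu c Phi x :
  record_sum a k mu (fun x => c * Phi x) x = c * record_sum a k mu Phi x.
Proof.
elim: k mu x => [|k IH] mu x /=; first by rewrite mulr0.
rewrite mulrCA mulrDr mulr_sumr; congr (_ + _).
by apply: eq_bigr => i _; rewrite IH.
Qed.

Section domination.
Variables (len a nu : T -> R).
Hypothesis len_half : forall x i, len (ch x i) = len x / 2.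
Hypothesis len_ge0 : forall x, 0 <= len x.
Hypothesis massnu : additive_mass nu.

(** Bound [a] by the current record, which is the sum of the increments of the record
    along the branch.  An increment made at a node is inherited by its descendants;
    there [len] halves at each generation while the total of [nu] does not change,
    so that the inherited copies form a geometric series and the increment counts
    at most twice.  The term in [mu] is the share of the record met at the root. *)
Lemma tree_sum_record_sum k mu x : 0 <= mu ->
  tree_sum k (fun x => len x * a x * nu x) x <=
  2 * (len x * nu x * mu) +
  2 * record_sum a k mu (fun x => len x * a x * nu x) x.
Proof.
have [nu0 nuE] := massnu.
elim: k mu x => [|k IH] mu x mu0 /=.
  by rewrite mulr0 addr0 !mulr_ge0.
set m := Num.max mu (a x).
have m0 : 0 <= m by rewrite le_max mu0.
have am : a x <= m by rewrite le_max lexx orbT.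
have child_sum : \sum_i 2 * (len (ch x i) * nu (ch x i) * m) = len x * nu x * m.
  rewrite (nuE x) mulr_sumr mulr_suml; apply: eq_bigr => i _.
  by rewrite len_half; field.
set S := \sum_i record_sum _ _ _ _ _.
have le1 : \sum_i tree_sum k (fun x => len x * a x * nu x) (ch x i) <=
    len x * nu x * m + 2 * S.
  rewrite -child_sum mulr_sumr -big_split/=; apply: ler_sum => i _.
  exact: IH.
have le2 : len x * a x * nu x <= len x * nu x * m.
  by rewrite mulrAC ler_wpM2l// mulr_ge0.
have gain : (m - mu) / m * (len x * a x * nu x) = len x * nu x * (m - mu).
  rewrite /m; case: leP => [h|h]; last by rewrite subrr !(mul0r, mulr0).
  have [a0|a0] := eqVneq (a x) 0; last by field.
  have -> : mu = 0 by apply/eqP; rewrite eq_le mu0 andbT -a0.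
  by rewrite a0 subrr !(mulr0, mul0r).
rewrite gain; lra.
Qed.

End domination.

Section embedding.
Variables (vol gam : T -> R).
Hypothesis vol_gt0 : forall x, 0 < vol x.
Hypothesis volE : forall x, vol x = \sum_i vol (ch x i).
Hypothesis massgam : additive_mass gam.
Local Notation a := (fun x => gam x / vol x).

Let rho (mu : R) x := let m := Num.max mu (a x) in (m - mu) / m + a x / m.

(** The Carleson property of the record weights, as a potential: [rho] is the weight of
    a node plus [a / m], and its mean over the children is at most the [a / m] of
    their parent, so that the potential drops by the weight of the parent.  At a
    child whose mean [b] beats the record [m] this is [2 - m / b <= b / m], and at the
    other children it is an equality. *)
Lemma record_density_child mu x : 0 <= mu ->
  \sum_i vol (ch x i) * rho (Num.max mu (a x)) (ch x i) <=
  vol x * (a x / Num.max mu (a x)).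
Proof.
move=> mu0; set m := Num.max mu (a x); have [gam0 gamE] := massgam.
have a_ge0 y : 0 <= a y by rewrite divr_ge0// ltW.
have am : a x <= m by rewrite le_max lexx orbT.
have m0 : 0 <= m by rewrite le_max mu0.
have -> : vol x * (a x / m) = \sum_i gam (ch x i) / m.
  by rewrite -mulr_suml -gamE mulrA [vol x * _]mulrC divfK// gt_eqF.
apply: ler_sum => i _.
have vi := vol_gt0 (ch x i).
have -> : gam (ch x i) / m = vol (ch x i) * (a (ch x i) / m).
  by rewrite /= mulrA [vol _ * _]mulrC divfK// gt_eqF.
rewrite ler_pM2l// /rho.
have [h|h] := leP (a (ch x i)) m.
  by rewrite subrr mul0r add0r.
have [m_eq0|m_neq0] := eqVneq m 0.
  have gx : gam x = 0.
    apply/eqP; rewrite eq_le gam0 andbT.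
    by have := am; rewrite m_eq0 /= ler_pdivrMr// mul0r.
  have : gam (ch x i) <= 0 by rewrite -gx; exact: additive_mass_child.
  by move: h; rewrite m_eq0 /= ltr_pdivlMr// mul0r => /lt_le_trans /[apply]; rewrite ltxx.
have mp : 0 < m by rewrite lt_neqAle eq_sym m_neq0.
set b := a _ in h *; have bp : 0 < b := le_lt_trans m0 h.
rewrite divff ?gt_eqF// -subr_ge0.
have -> : b / m - ((b - m) / b + 1) = (b - m) ^+ 2 / (b * m).
  by field; rewrite !gt_eqF.
by rewrite divr_ge0 ?sqr_ge0// mulr_ge0// ltW.
Qed.

(** Carleson's embedding theorem, with the Bellman function in the right-hand side:
    it is nonnegative by [jensen], and its sum over the children falls short of its
    value at the parent by at least the term of the parent. *)
Lemma record_embedding P (X Z : T -> R) k mu x : 1 < P ->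
  additive_mass X -> additive_mass Z ->
  (forall x, vol x * (X x / vol x) `^ P <= Z x) -> 0 <= mu ->
  record_sum a k mu (fun x => vol x * (X x / vol x) `^ P) x <=
  3 `^ P / (P - 1) *
  (Z x - vol x * (X x / vol x) `^ P / (1 + rho mu x) `^ (P - 1)).
Proof.
move=> P1 [X0 XE] [Z0 ZE] jensen.
have P10 : 0 < P - 1 by rewrite subr_gt0.
have gam0 := massgam.1.
have a_ge0 y : 0 <= a y by rewrite divr_ge0// ltW.
have C0 : 0 <= 3 `^ P / (P - 1) by rewrite divr_ge0 ?powR_ge0// ltW.
have xi0 y : 0 <= X y / vol y by rewrite divr_ge0// ltW.
have rho0 nu y : 0 <= nu -> 0 <= rho nu y.
  move=> nu0; have m0 : 0 <= Num.max nu (a y) by rewrite le_max nu0.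
  by rewrite addr_ge0// divr_ge0// subr_ge0 le_max lexx.
elim: k mu x => [|k IH] mu x mu0 /=.
  rewrite mulr_ge0// subr_ge0 (le_trans _ (jensen x))//.
  rewrite ler_pdivrMr ?powR_gt0 ?ltr_wpDr ?rho0//.
  rewrite ler_peMr ?mulr_ge0 ?powR_ge0 ?(ltW (vol_gt0 x))//.
  rewrite -[leLHS](powRr0 (1 + rho mu x)); apply: ler_powR; last exact: ltW.
  by rewrite lerDl rho0.
set m := Num.max mu (a x); set th := (m - mu) / m.
have m0 : 0 <= m by rewrite le_max mu0.
have am : a x <= m by rewrite le_max lexx orbT.
have th0 : 0 <= th by rewrite divr_ge0// subr_ge0 le_max lexx.
have ratio1 (r : R) : r <= m -> r / m <= 1.
  move=> rm; have [->|mn0] := eqVneq m 0; first by rewrite invr0 mulr0.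
  by rewrite ler_pdivrMr ?mul1r// lt_neqAle eq_sym mn0.
have th1 : th <= 1 by apply: ratio1; rewrite lerBlDr lerDl.
set b := a x / m.
have b0 : 0 <= b by rewrite divr_ge0.
have b1 : b <= 1 by exact: ratio1.
have rhoE : rho mu x = th + b by [].
set xi := X x / vol x.
pose tau := xi / (1 + b).
have B0 : 0 < 1 + b by rewrite ltr_wpDr.
have tau0 : 0 <= tau := divr_ge0 (xi0 x) (ltW B0).
have B0' : 0 < 1 + (th + b) by rewrite ltr_wpDr// addr_ge0.
(* Jensen's inequality for the perspective of the power, with the tangent plane
   whose slope [tau] is that of the parent after its weight has been removed. *)
have jump : \sum_i vol (ch x i) * (X (ch x i) / vol (ch x i)) `^ P /
      (1 + rho m (ch x i)) `^ (P - 1) >= vol x * (xi `^ P / (1 + b) `^ (P - 1)).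
  apply: (@le_trans _ _ (\sum_i vol (ch x i) *
    (P * (X (ch x i) / vol (ch x i)) * tau `^ (P - 1) -
     (P - 1) * (1 + rho m (ch x i)) * tau `^ P))); last first.
    apply: ler_sum => i _; rewrite -[leRHS]mulrA ler_pM2l//.
    by apply: powR_perspective_tangent; rewrite ?ltr_wpDr ?rho0.
  have -> : \sum_i vol (ch x i) *
    (P * (X (ch x i) / vol (ch x i)) * tau `^ (P - 1) -
     (P - 1) * (1 + rho m (ch x i)) * tau `^ P) =
    P * X x * tau `^ (P - 1) - (P - 1) * tau `^ P *
      (vol x + \sum_i vol (ch x i) * rho m (ch x i)).
    rewrite (XE x) (volE x) -big_split/= mulr_sumr mulr_suml mulr_sumr -sumrB.
    by apply: eq_bigr => i _; field; rewrite gt_eqF.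
  have dens := record_density_child mu x mu0.
  apply: (@le_trans _ _ (P * X x * tau `^ (P - 1) - (P - 1) * tau `^ P *
     (vol x + vol x * b))); last first.
    by rewrite lerB// ler_wpM2l ?mulr_ge0 ?powR_ge0 ?lerD2l ?(ltW P10).
  have -> : X x = vol x * xi by rewrite /xi mulrC divfK// gt_eqF.
  have tauP : xi `^ P / (1 + b) `^ (P - 1) = (1 + b) * tau `^ P.
    have BP : (1 + b) `^ P = (1 + b) `^ (P - 1) * (1 + b).
      by rewrite mulrC mulr_powRB1// ?(ltW B0)// (lt_trans _ P1).
    rewrite /tau (powR_div _ _ _ (xi0 x) (ltW B0)) BP.
    by field; rewrite !gt_eqF// powR_gt0.
  have tauP1 : xi * tau `^ (P - 1) = (1 + b) * tau `^ P.
    rewrite -(mulr_powRB1 tau0 (lt_trans ltr01 P1)) mulrA; congr (_ * _).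
    by rewrite /tau mulrC divfK// gt_eqF.
  rewrite tauP -subr_ge0 [leRHS](_ : _ = 0)//.
  have -> : P * (vol x * xi) * tau `^ (P - 1) =
    P * vol x * (xi * tau `^ (P - 1)) by ring.
  by rewrite tauP1; ring.
(* Convexity of [M `^ (1 - P)] between [1 + b] and [1 + (th + b)], both in [1, 3]:
   the drop of the potential by [th] pays for the term of the node. *)
have pay : th * (xi `^ P) <= 3 `^ P / (P - 1) *
   (xi `^ P / (1 + b) `^ (P - 1) - xi `^ P / (1 + (th + b)) `^ (P - 1)).
  have := @powR_perspective_tangent _ P 1 (1 + b) (1 + (th + b))^-1 P1 ler01 B0.
  rewrite invr_ge0 ltW// => /(_ erefl).
  rewrite !(powR_inv _ _ (ltW B0')) powR1 mulr1.
  have BP : (1 + (th + b)) `^ P = (1 + (th + b)) `^ (P - 1) * (1 + (th + b)).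
    by rewrite mulrC mulr_powRB1// ?ltW// (lt_trans _ P1).
  set V := _ `^ (P - 1) in BP *; have V0 : 0 < V by rewrite powR_gt0.
  rewrite BP.
  have -> : P * V^-1 - (P - 1) * (1 + b) * (V * (1 + (th + b)))^-1 =
    V^-1 + (P - 1) * th * (V * (1 + (th + b)))^-1 by field; rewrite !gt_eqF.
  rewrite -BP mul1r => ineq.
  have V3 : (1 + (th + b)) `^ P <= 3 `^ P.
    by rewrite ge0_ler_powR ?nnegrE// ?(ltW (lt_trans _ P1))//; lra.
  have VP0 : 0 < (1 + (th + b)) `^ P by rewrite powR_gt0.
  have h1 : (3 `^ P)^-1 <= ((1 + (th + b)) `^ P)^-1 by rewrite lef_pV2 ?posrE ?powR_gt0.
  have h2 : (P - 1) * th * (3 `^ P)^-1 <= (P - 1) * th * ((1 + (th + b)) `^ P)^-1.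
    by rewrite ler_wpM2l// mulr_ge0// ltW.
  rewrite -mulrBr mulrCA mulrC ler_wpM2l ?powR_ge0//.
  rewrite -[th](_ : 3 `^ P / (P - 1) * ((P - 1) * th * (3 `^ P)^-1) = _); last first.
    by field; rewrite !gt_eqF// powR_gt0.
  by rewrite ler_wpM2l//; lra.
rewrite rhoE.
have {}IH : \sum_i record_sum a k m (fun x0 => vol x0 * (X x0 / vol x0) `^ P) (ch x i) <=
   3 `^ P / (P - 1) * (Z x - vol x * (xi `^ P / (1 + b) `^ (P - 1))).
  apply: (@le_trans _ _ (3 `^ P / (P - 1) * (Z x -
     \sum_i vol (ch x i) * (X (ch x i) / vol (ch x i)) `^ P /
       (1 + rho m (ch x i)) `^ (P - 1)))); last by rewrite ler_wpM2l// lerB.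
  rewrite (ZE x) -sumrB mulr_sumr; apply: ler_sum => i _; exact: IH.
have {}pay := ler_wpM2l (ltW (vol_gt0 x)) pay.
rewrite -[vol x * _ / _]mulrA; apply: le_trans (lerD (lexx _) IH) _.
rewrite mulrCA; apply: le_trans (lerD pay (lexx _)) _.
rewrite le_eqVlt; apply/orP; left; apply/eqP; ring.
Qed.

Lemma record_embedding_le P (X Z : T -> R) k x : 1 < P ->
  additive_mass X -> additive_mass Z ->
  (forall x, vol x * (X x / vol x) `^ P <= Z x) ->
  record_sum a k 0 (fun x => vol x * (X x / vol x) `^ P) x <=
  3 `^ P / (P - 1) * Z x.
Proof.
move=> P1 mX mZ jensen; apply: le_trans (record_embedding _ _ _ k 0 x P1 mX mZ jensen _) _ => //.
have P10 : 0 < P - 1 by rewrite subr_gt0.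
rewrite ler_wpM2l ?divr_ge0 ?powR_ge0 ?(ltW P10)// lerBlDr lerDl.
by rewrite divr_ge0 ?powR_ge0// mulr_ge0 ?powR_ge0// ltW.
Qed.

Definition embedding_cst (P : R) : R := 3 `^ P / (P - 1).

(** By [key] each term is a product of two factors, the [p]-th power of the first and
    the [q']-th power of the second being summable by [record_embedding]; this needs
    [s < p] and [t < q'].  Once normalised by [xi] and [eta] the product is split by
    Young's inequality with the exponents [p] and [p'].  Since [q' <= p'] and the
    second factor is at most 1, the exponent [p'] may be replaced by [q']. *)
Lemma tree_bilinear (p q s t A xi eta : R) (len nu X Y ZX ZY : T -> R) k x :
  1 < p -> 1 < q -> p <= q -> 0 < s < p -> 0 < t < conj_exp q ->
  0 <= A -> 0 < xi -> 0 < eta ->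
  (forall x i, len (ch x i) = len x / 2) -> (forall x, 0 <= len x) ->
  additive_mass nu -> additive_mass X -> additive_mass Y ->
  additive_mass ZX -> additive_mass ZY ->
  (forall x, vol x * (X x / vol x) `^ (p / s) <= ZX x) ->
  (forall x, vol x * (Y x / vol x) `^ (conj_exp q / t) <= ZY x) ->
  (forall x, len x * (gam x / vol x) * nu x <=
     A * ((vol x `^ p^-1 * (X x / vol x) `^ s^-1) *
          (vol x `^ (conj_exp q)^-1 * (Y x / vol x) `^ t^-1))) ->
  ZX x <= xi `^ p -> ZY x <= eta `^ conj_exp q ->
  tree_sum k (fun x => len x * (gam x / vol x) * nu x) x <=
  2 * (embedding_cst (p / s) + embedding_cst (conj_exp q / t)) * (A * xi * eta).
Proof.
move=> p1 q1 pq /andP[s0 sp] /andP[t0 tq] A0 xi0 eta0 len_half len_ge0.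
move=> mnu mX mY mZX mZY jX jY key ZXx ZYx.
have p0 : 0 < p := lt_trans ltr01 p1.
have q0 : 0 < q := lt_trans ltr01 q1.
have p10 : 0 < p - 1 by rewrite subr_gt0.
have q10 : 0 < q - 1 by rewrite subr_gt0.
set q' := conj_exp q in tq jY key ZYx *.
have q'0 : 0 < q' by rewrite divr_gt0.
have q'p' : q' <= conj_exp p.
  by rewrite /q' /conj_exp ler_pdivrMr// mulrAC ler_pdivlMr//; lra.
have avg0 (m : T -> R) y : additive_mass m -> 0 <= m y / vol y.
  by move=> [m0 _]; rewrite divr_ge0// ltW.
apply: (le_trans (tree_sum_record_sum _ _ _ len_half len_ge0 mnu k 0 x _)) => //.
rewrite mulr0 mulr0 add0r -mulrA ler_wpM2l//.
pose PhiX y := vol y * (X y / vol y) `^ (p / s).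
pose PhiY y := vol y * (Y y / vol y) `^ (q' / t).
pose c1 := A * xi * eta / xi `^ p; pose c2 := A * xi * eta / eta `^ q'.
have Axe : 0 <= A * xi * eta by rewrite !mulr_ge0// ltW.
apply: (@le_trans _ _ (record_sum a k 0 (fun y => c1 * PhiX y + c2 * PhiY y) x)).
  apply: (record_sum_le (fun y => ZY y <= eta `^ q')) => //.
    by move=> y i; apply: le_trans; exact: additive_mass_child.
  move=> y ZYy; apply: le_trans (key y) _.
  set al := _ * _ `^ s^-1; set be := _ * _ `^ t^-1.
  have al0 : 0 <= al by rewrite mulr_ge0 ?powR_ge0.
  have be0 : 0 <= be by rewrite mulr_ge0 ?powR_ge0.
  have alE : al `^ p = PhiX y.
    rewrite powRM ?powR_ge0// -!powRrM mulVf ?gt_eqF// powRr1 ?(ltW (vol_gt0 _))//.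
    by rewrite [s^-1 * p]mulrC.
  have beE : be `^ q' = PhiY y.
    rewrite powRM ?powR_ge0// -!powRrM mulVf ?gt_eqF// powRr1 ?(ltW (vol_gt0 _))//.
    by rewrite [t^-1 * q']mulrC.
  have be1 : be / eta <= 1.
    rewrite ler_pdivrMr// mul1r leNgt; apply/negP => h.
    have := gt0_ltr_powR q'0; move=> /(_ eta be); rewrite !nnegrE (ltW eta0) be0.
    move=> /(_ erefl erefl h); rewrite beE ltNge => /negP; apply.
    exact: le_trans (jY y) ZYy.
  have be10 : 0 <= be / eta by rewrite divr_ge0// ltW.
  have al10 : 0 <= al / xi by rewrite divr_ge0// ltW.
  have young : al / xi * (be / eta) <= (al / xi) `^ p + (be / eta) `^ q'.
    have p'0 : 0 < conj_exp p by rewrite divr_gt0.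
    have conj1 : p^-1 + (conj_exp p)^-1 = 1 by rewrite /conj_exp; field; rewrite !gt_eqF.
    apply: le_trans (conjugate_powR al10 be10 p0 p'0 conj1) _.
    have le_div (z c : R) : 0 <= z -> 1 <= c -> z / c <= z.
      move=> z0 c1'; rewrite ler_pdivrMr ?(lt_le_trans ltr01)//.
      by rewrite ler_peMr.
    apply: lerD; first by rewrite le_div ?powR_ge0// ltW.
    apply: (@le_trans _ _ ((be / eta) `^ conj_exp p)).
      rewrite le_div ?powR_ge0// ler_pdivlMr// mul1r.
      by rewrite lerBlDr lerDl.
    have [->|b0] := eqVneq (be / eta) 0; first by rewrite !powR0 ?gt_eqF.
    by apply: ger_powR => //; rewrite be1 andbT lt_neqAle eq_sym b0.
  have -> : A * (al * be) = A * xi * eta * (al / xi * (be / eta)).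
    by field; rewrite !gt_eqF.
  apply: le_trans (ler_wpM2l Axe young) _.
  rewrite !powR_div ?(ltW xi0) ?(ltW eta0)// alE beE.
  by rewrite /c1 /c2 mulrDr !mulrA ![_ / _ `^ _ * _]mulrAC.
rewrite record_sumD !record_sumZ mulrDl ![embedding_cst _ * _]mulrC.
apply: lerD.
  rewrite /c1 -mulrA ler_wpM2l// mulrC ler_pdivrMr ?powR_gt0//.
  apply: le_trans (record_embedding_le _ _ _ _ _ _ mX mZX jX) _.
    by rewrite ltr_pdivlMr// mul1r.
  rewrite ler_wpM2l// divr_ge0 ?powR_ge0// subr_ge0 ler_pdivlMr// mul1r.
  exact: ltW.
rewrite /c2 -mulrA ler_wpM2l// mulrC ler_pdivrMr ?powR_gt0//.
apply: le_trans (record_embedding_le _ _ _ _ _ _ mY mZY jY) _.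
  by rewrite ltr_pdivlMr// mul1r.
rewrite ler_wpM2l// divr_ge0 ?powR_ge0// subr_ge0 ler_pdivlMr// mul1r.
exact: ltW.
Qed.

End embedding.

End trees.

(** * Translation invariance and integration along lines *)

Section borel.
Context {R : realType}.
Local Notation lambda := (@lebesgue_measure R).
Local Notation mu0 n := (product_lebesgue R n).
Local Notation mu n := (lebesgue_rV R n).

Lemma measurable_addV n (a : 'rV[R]_n) :
  measurable_fun [set: 'rV[R]_n] (fun x => x + a).
Proof.
apply: measurable_fun_rVP => i.
under eq_fun do rewrite mxE.
apply: measurable_funD; last exact: measurable_cst.
exact: measurable_coord.
Qed.

Definition pushforward_measure {d d'} {T1 : measurableType d} {T2 : measurableType d'}
    (m : {measure set T1 -> \bar R}) {f : T1 -> T2}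
    (mf : measurable_fun setT f) : {measure set T2 -> \bar R} :=
  measure_function_pushforward__canonical__measure_function_Measure m mf.

Lemma lebesgue_measure_shift (a : R) A : measurable A ->
  lambda ((fun x : measurableTypeR R => x + a : measurableTypeR R) @^-1` A) = lambda A.
Proof.
move=> mA.
have mf : measurable_fun [set: measurableTypeR R] (fun x : measurableTypeR R =>
  x + a : measurableTypeR R).
  by apply: measurable_funD => //; exact: measurable_cst.
suff /(_ A mA) h : forall A, measurable A -> lambda A = pushforward_measure lambda mf A by
  exact: (esym h).
apply: lebesgue_measure_unique.
move=> X [[u v] _ <-].
apply: (@etrans _ _ (lambda `]u - a, v - a]%classic)).
  rewrite !lebesgue_measure_itv/= !lte_fin ltrD2r.
  by case: ifPn => // _; rewrite -!EFinD; congr EFin; ring.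
by congr (lambda _); apply/seteqP; split => x /=; rewrite !in_itv/= ltrBlDr lerBrDr.
Qed.

(** By induction on the dimension: a translation acts on each factor of the product, and
    a product measure is determined by its values on rectangles. *)
Lemma product_lebesgue_shift n (a : 'rV[R]_n) A : measurable A ->
  mu0 n ((fun x => x + a) @^-1` A) = mu0 n A.
Proof.
elim: n => [|n IH] in a A *.
  move=> mA; congr (mu0 0 _); apply/seteqP; split => x /=;
   by rewrite (_ : x + a = x)//; apply/rowP => -[].
move=> mA; pose a0 : R := a ord0 ord0; pose a' : 'rV[R]_n := \row_i a ord0 (lift ord0 i).
pose f (z : measurableTypeR R * 'rV[R]_n) : measurableTypeR R * 'rV[R]_n :=
  (z.1 + a0, z.2 + a').
have mf : measurable_fun setT f.
  apply/measurable_fun_pairP; split.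
    by apply: measurable_funD; [exact: measurable_fst|exact: measurable_cst].
  exact: (measurableT_comp (measurable_addV n a') measurable_snd).
have mcA : measurable (@consrV R n @^-1` A).
  by rewrite -[X in measurable X]setTI; exact: measurable_consrV.
have consrV_shift z : consrV z + a = consrV (f z).
  apply/rowP => i; case: (unliftP ord0 i) => [j ->|->].
    by rewrite [LHS]mxE !consrVS [RHS]mxE mxE.
  by rewrite [LHS]mxE !consrV0.
apply: (@etrans _ _ ((lambda \x mu0 n) (f @^-1` (@consrV R n @^-1` A)))%E).
  congr (lambda \x mu0 n)%E; apply/seteqP; split => z /=; by rewrite consrV_shift.
suff /(_ _ mcA) h : forall B, measurable B -> (lambda \x mu0 n)%E B =
   pushforward_measure (lambda \x mu0 n)%E mf B by exact: (esym h).
apply: product_measure_unique => // X Y mX mY.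
rewrite [LHS](_ : _ = (lambda \x mu0 n)%E (((fun x : measurableTypeR R =>
  x + a0 : measurableTypeR R) @^-1` X) `*` ((fun x => x + a') @^-1` Y))) //.
rewrite product_measure1E//.
- congr (_ * _)%E; [exact: lebesgue_measure_shift|exact: IH].
- rewrite -[X in measurable X]setTI.
  by apply: (measurable_funD (@measurable_id _ _ _) (measurable_cst _)).
- by rewrite -[X in measurable X]setTI; exact: measurable_addV.
Qed.

Lemma measurable_line n (v : 'rV[R]_n) :
  measurable_fun setT (fun z : 'rV[R]_n * measurableTypeR R => z.1 + (z.2 : R) *: v).
Proof.
apply: measurable_fun_rVP => i.
under eq_fun do rewrite !mxE.
apply: measurable_funD.
  exact: (measurableT_comp (measurable_coord _) measurable_fst).
apply: measurable_funM; last exact: measurable_cst.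
exact: measurable_snd.
Qed.

Lemma integral_translate n (G : 'rV[R]_n -> \bar R) (a : 'rV[R]_n) :
  measurable_fun setT G -> (forall x, 0 <= G x)%E ->
  (\int[mu0 n]_x G (x + a)%R = \int[mu0 n]_x G x)%E.
Proof.
move=> mG G0.
have mf := measurable_addV n a.
transitivity (\int[pushforward_measure (mu0 n) mf]_x G x)%E; last first.
  by apply: eq_measure_integral => A mA _; exact: product_lebesgue_shift.
by rewrite ge0_integral_pushforward// preimage_setT.
Qed.

Lemma measurable_segment_integrand n (G : 'rV[R]_n -> \bar R) (v : 'rV[R]_n) (h : R) :
  measurable_fun setT G ->
  measurable_fun setT (fun z : 'rV[R]_n * measurableTypeR R =>
    G (z.1 + (z.2 : R) *: v)%R * (\1_(`]0%R, h]%classic : set R) (z.2 : R))%:E)%E.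
Proof.
move=> mG; apply: emeasurable_funM; first exact: (measurableT_comp mG (measurable_line n v)).
apply/measurable_EFinP; apply: (measurableT_comp _ measurable_snd).
by apply: measurable_indic; exact: measurable_itv.
Qed.

Lemma segment_integralE n (G : 'rV[R]_n -> \bar R) (v : 'rV[R]_n) (h : R) x :
  (\int[lambda]_(s in `]0%R, h]) G (x + (s : R) *: v)%R =
   \int[lambda]_s (G (x + (s : R) *: v)%R * (\1_(`]0%R, h]%classic : set R) (s : R))%:E))%E.
Proof. by rewrite integral_mkcond epatch_indic. Qed.

Lemma measurable_segment n (G : 'rV[R]_n -> \bar R) (v : 'rV[R]_n) (h : R) :
  measurable_fun setT G -> (forall x, 0 <= G x)%E ->
  measurable_fun setT (fun x : 'rV[R]_n =>
    \int[lambda]_(s in `]0%R, h]) G (x + (s : R) *: v)%R)%E.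
Proof.
move=> mG G0; under eq_fun do rewrite segment_integralE.
apply: (measurable_fun_fubini_tonelli_F _ (measurable_segment_integrand n G v h mG)).
by move=> z; rewrite mule_ge0// lee_fin.
Qed.

(** Tonelli's theorem, then translation invariance for each [s]. *)
Lemma integral_segment n (G : 'rV[R]_n -> \bar R) (v : 'rV[R]_n) (h : R) :
  0 <= h -> measurable_fun setT G -> (forall x, 0 <= G x)%E ->
  (\int[mu0 n]_x \int[lambda]_(s in `]0%R, h]) G (x + (s : R) *: v)%R
   = h%:E * \int[mu0 n]_x G x)%E.
Proof.
move=> h0 mG G0; have mF := measurable_segment_integrand n G v h mG.
have mI : measurable (`]0%R, h]%classic : set (measurableTypeR R)) by exact: measurable_itv.
have F0 (z : 'rV[R]_n * measurableTypeR R) :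
    (0 <= G (z.1 + (z.2 : R) *: v)%R * (\1_(`]0%R, h]%classic : set R) (z.2 : R))%:E)%E.
  by rewrite mule_ge0// lee_fin.
under eq_integral do rewrite segment_integralE.
rewrite (fubini_tonelli _ mF)//=.
transitivity (\int[lambda]_s ((\1_(`]0%R, h]%classic : set R) (s : R))%:E * \int[mu0 n]_x G x))%E.
  apply: eq_integral => s _.
  under eq_integral do rewrite muleC.
  rewrite ge0_integralZl_EFin//.
  - by congr (_ * _)%E; exact: integral_translate.
  - exact: (measurableT_comp mG (measurable_addV n _)).
rewrite ge0_integralZr//; last first.
- by apply: integral_ge0.
- by apply/measurable_EFinP; exact: measurable_indic.
rewrite integral_indic// setIT; congr (_ * _)%E.
apply: (etrans (lebesgue_measure_itv _)) => /=; rewrite lte_fin.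
move: h0; rewrite le_eqVlt => /predU1P[<-|->]; last by rewrite -EFinD subr0.
by rewrite ltxx.
Qed.

(** The measure of [N] is the integral over [x] of the measure of the part of [N] on the
    unit segment issued from [x] in the direction [v], by [integral_segment]. *)
Lemma slices_null n (N : set 'rV[R]_n) (v : 'rV[R]_n) : measurable N ->
  (forall x, lambda [set s : measurableTypeR R |
     (s : R) \in `]0, 1] /\ N (x + (s : R) *: v)] = 0%E) ->
  mu0 n N = 0%E.
Proof.
move=> mN slices.
have := integral_segment n (EFin \o \1_N) v 1 ler01.
rewrite integral_indic// setIT mul1e => <-; last 2 first.
- by apply/measurable_EFinP; exact: measurable_indic.
- by move=> x; rewrite lee_fin.
apply: integral0_eq => x _.
have mI : measurable (`]0%R, 1%R]%classic : set (measurableTypeR R)) by exact: measurable_itv.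
have mpre : measurable [set s : measurableTypeR R | N (x + (s : R) *: v)].
  have := measurableT_comp (measurable_line n v) (@measurable_pair1 _ _ _ _ x).
  by move=> /(_ measurableT _ mN); rewrite setTI.
transitivity (\int[lambda]_(s in `]0%R, 1%R])
  (\1_[set s : measurableTypeR R | N (x + (s : R) *: v)%R] s)%:E)%E.
  by apply: eq_integral => s _; rewrite /= !indicE; congr (EFin _%:R); apply/idP/idP;
    rewrite !inE.
rewrite integral_indic// -[RHS](slices x); congr (lambda _).
by apply/seteqP; split => s /= [].
Qed.

End borel.

(** * Borel and Lebesgue measurability *)

(** The points of the space with the Lebesgue measurable sets; the measurable sets of
    ['rV[R]_n] itself are the Borel sets. *)
Definition lebesgue_type (R : realType) n := caratheodory_type (product_lebesgue R n)^*%mu.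

Section lebesgue.
Context {R : realType}.
Local Notation lambda := (@lebesgue_measure R).
Local Notation mu0 n := (product_lebesgue R n).
Local Notation mu n := (lebesgue_rV R n).

Lemma borel_lebesgue n (A : set 'rV[R]_n) : measurable A ->
  measurable (A : set (lebesgue_type R n)).
Proof. by move=> mA; apply: sub_caratheodory; exact: sub_sigma_algebra. Qed.

Lemma lebesgue_rVE n (A : set 'rV[R]_n) : measurable A -> mu n A = mu0 n A.
Proof. by move=> mA; rewrite /lebesgue_rV /completed_measure_extension /= measurable_mu_extE. Qed.

Lemma measurable_borel_id n :
  measurable_fun setT (id : lebesgue_type R n -> 'rV[R]_n).
Proof. by move=> _ A mA; rewrite setTI; exact: borel_lebesgue. Qed.

Lemma measurable_fun_lebesgue n d (U : measurableType d) (D : set 'rV[R]_n)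
    (f : 'rV[R]_n -> U) : measurable D ->
  measurable_fun D f -> measurable_fun (D : set (lebesgue_type R n)) f.
Proof. by move=> mD mf _ B mB; apply: borel_lebesgue; exact: mf. Qed.

(** The completion of a measure integrates the functions measurable for the original
    sigma-algebra as before; translation invariance and Tonelli's theorem are thus
    at hand for Borel functions. *)
Lemma integral_lebesgue_rV n (D : set 'rV[R]_n) (f : 'rV[R]_n -> \bar R) :
  measurable D -> measurable_fun D f -> (forall x, D x -> 0 <= f x)%E ->
  (\int[mu n]_(x in D) f x = \int[mu0 n]_(x in D) f x)%E.
Proof.
move=> mD mf f0; have mid := measurable_borel_id n.
transitivity (\int[pushforward_measure (mu n) mid]_(x in D) f x)%E; last first.
  by apply: eq_measure_integral => A mA _; exact: lebesgue_rVE.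
rewrite ge0_integral_pushforward// => x; rewrite inE; exact: f0.
Qed.

(** An open set is the union of the boxes with rational data that it contains. *)
Lemma open_measurable_rV n (U : set 'rV[R]_n) : open U -> measurable U.
Proof.
move=> oU.
pose box (z : 'rV[rat]_n * nat) : set 'rV[R]_n :=
  [set x | forall i, `|ratr (z.1 ord0 i) - x ord0 i| < z.2.+1%:R^-1].
have mbox z : measurable (box z).
  rewrite (_ : box z = \big[setI/setT]_(i <- enum 'I_n)
     ((fun x : 'rV[R]_n => x ord0 i : measurableTypeR R) @^-1` ball (ratr (z.1 ord0 i) : R)
       z.2.+1%:R^-1)).
    apply: bigsetI_measurable => i _; rewrite -[X in measurable X]setTI.
    by apply: measurable_coord => //; exact: measurable_ball.
  rewrite -bigcap_seq; apply/seteqP; split => x /=.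
    by move=> xz i _; exact: xz.
  by move=> xz i; apply: xz; rewrite /= mem_enum.
have -> : U = \bigcup_(z in [set z | box z `<=` U]) box z.
  apply/seteqP; split => [x Ux|x [z zU zx]]; last exact: zU.
  have /nbhs_ballP[e /= e0 xeU] : nbhs x U by exact: open_nbhs_nbhs.
  have [k ke] : exists k : nat, k.+1%:R^-1 < e / 2 :> R.
    have e20 : 0 < e / 2 by rewrite divr_gt0.
    have [k _ /(_ k (leqnn k)) ke] := near_infty_natSinv_lt (PosNum e20).
    by exists k.
  have /choice[c cP] i : exists q : rat, `|ratr q - x ord0 i| < k.+1%:R^-1.
    have [q] := @rat_in_itvoo R (x ord0 i - k.+1%:R^-1) (x ord0 i + k.+1%:R^-1)
      ltac:(by rewrite ltrD2l gtrN).
    by rewrite in_itv/= => qx; exists q; rewrite ltr_distl.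
  exists (\row_i c i, k) => /=; last by move=> i; rewrite mxE; exact: cP.
  move=> y yz; apply: xeU; split => // i j; rewrite ord1 /ball/=.
  have := yz j; have := cP j; rewrite mxE /= => h1 h2.
  have -> : x ord0 j - y ord0 j = (ratr (c j) - y ord0 j) - (ratr (c j) - x ord0 j) by ring.
  apply: (le_lt_trans (ler_normB _ _)); rewrite [ltRHS](splitr e).
  by apply: ltrD; [exact: lt_trans h2 ke|exact: lt_trans h1 ke].
rewrite bigcup_mkcond.
rewrite (_ : \bigcup_i _ = \bigcup_k (if @unpickle ('rV[rat]_n * nat)%type k is Some z then
   if z \in [set z | box z `<=` U] then box z else set0 else set0)); last first.
  apply/seteqP; split => x.
    by move=> [z _ zx]; exists (pickle z) => //; rewrite pickleK.
  by move=> [k _]; case: unpickle => // z zx; exists z.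
apply: bigcupT_measurable => k; case: unpickle => [z|]; last exact: measurable0.
by case: ifP => _; [exact: mbox|exact: measurable0].
Qed.

Lemma continuous_measurable_rV n (f : 'rV[R]_n -> R) : continuous f ->
  measurable_fun setT (f : _ -> measurableTypeR R).
Proof.
move=> /continuousP cf; apply: (measurability _ (RGenOpens.measurableE R)).
move=> _ [_ [a [b ->] <-]]; rewrite setTI; apply: open_measurable_rV.
by apply: cf; exact: interval_open.
Qed.

End lebesgue.

(** * Cubes and their bisection *)

Section cubes.
Context {R : realType}.
Local Notation lambda := (@lebesgue_measure R).
Local Notation mu0 n := (product_lebesgue R n).
Local Notation mu n := (lebesgue_rV R n).

Lemma measurable_box n (A : 'I_n -> set (measurableTypeR R)) :
  (forall i, measurable (A i)) -> measurable [set x : 'rV[R]_n | forall i, A i (x ord0 i)].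
Proof.
move=> mA.
rewrite (_ : mkset _ = \big[setI/setT]_(i <- enum 'I_n)
   ((fun x : 'rV[R]_n => x ord0 i : measurableTypeR R) @^-1` A i)).
  apply: bigsetI_measurable => i _; rewrite -[X in measurable X]setTI.
  exact: measurable_coord.
rewrite -bigcap_seq; apply/seteqP; split => x /=.
  by move=> xz i _; exact: xz.
by move=> xz i; apply: xz; rewrite /= mem_enum.
Qed.

Lemma product_lebesgue_box n (A : 'I_n -> set (measurableTypeR R)) (l : R) :
  (forall i, measurable (A i)) -> (forall i, lambda (A i) = l%:E) ->
  mu0 n [set x : 'rV[R]_n | forall i, A i (x ord0 i)] = (l ^+ n)%:E.
Proof.
elim: n => [|n IH] in A *.
  move=> mA lA; rewrite [mkset _](_ : _ = setT) /=; last first.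
    by apply/seteqP; split => x // _ [].
  by rewrite expr0 diracT.
move=> mA lA.
rewrite [LHS](_ : _ = (lambda \x mu0 n)%E (A ord0 `*`
   [set y : 'rV[R]_n | forall i, A (lift ord0 i) (y ord0 i)])); last first.
  congr (lambda \x mu0 n)%E; apply/seteqP; split => z /=.
    move=> h; split => /=; first by have := h ord0; rewrite consrV0.
    by move=> i; have := h (lift ord0 i); rewrite consrVS.
  move=> [/= h0 h] i; case: (unliftP ord0 i) => [j ->|->].
    by rewrite consrVS.
  by rewrite consrV0.
rewrite product_measure1E//; last exact: (measurable_box n (fun i => A (lift ord0 i))).
by rewrite [X in (X * _)%E]lA [X in (_ * X)%E](IH (fun i => A (lift ord0 i)))// exprS.
Qed.

Lemma measurable_cube n (P : cube R n) : measurable (P : set 'rV[R]_n).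
Proof.
by apply: (measurable_box n (fun i => `[corner P ord0 i, corner P ord0 i + side P]%classic)).
Qed.

Lemma product_lebesgue_cube n (P : cube R n) : mu0 n P = (side P ^+ n)%:E.
Proof.
apply: (product_lebesgue_box n
  (fun i => `[corner P ord0 i, corner P ord0 i + side P]%classic)) => // i.
apply: (etrans (lebesgue_measure_itv _)) => /=.
by rewrite lte_fin ltrDl side_gt0 -EFinD addrAC subrr add0r.
Qed.

Lemma lebesgue_cube n (P : cube R n) : mu n P = (side P ^+ n)%:E.
Proof. by rewrite lebesgue_rVE ?product_lebesgue_cube//; exact: measurable_cube. Qed.

Lemma volE n (P : cube R n) : vol (P : set 'rV[R]_n) = side P ^+ n.
Proof. by rewrite /vol lebesgue_cube. Qed.

Lemma vol_gt0 n (P : cube R n) : 0 < vol (P : set 'rV[R]_n).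
Proof. by rewrite volE exprn_gt0// side_gt0. Qed.

(** A line parallel to the [i]-th axis meets the hyperplane in one point. *)
Lemma hyperplane_null n (i : 'I_n) (c : R) :
  measurable [set x : 'rV[R]_n | x ord0 i = c] /\
  mu0 n [set x : 'rV[R]_n | x ord0 i = c] = 0%E.
Proof.
have mH : measurable [set x : 'rV[R]_n | x ord0 i = c].
  have := measurable_coord i measurableT (measurable_set1 (c : measurableTypeR R)).
  by rewrite setTI.
split => //; apply: (slices_null n _ (delta_mx ord0 i) mH) => x.
apply: countable_lebesgue_measure0.
apply: (@sub_countable _ _ _ [set c - x ord0 i]); last exact: countable1.
apply: subset_card_le => s /= [_]; rewrite !mxE !eqxx mulr1 => <-.
by rewrite [RHS]addrC addKr.
Qed.

(** These hyperplanes contain the overlaps of distinct children. *)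
Definition midplanes n (P : cube R n) : set 'rV[R]_n :=
  \big[setU/set0]_(i < n) [set x : 'rV[R]_n | x ord0 i = corner P ord0 i + side P / 2].

Lemma midplanes_null n (P : cube R n) :
  measurable (midplanes n P) /\ mu0 n (midplanes n P) = 0%E.
Proof.
have mZ : measurable (midplanes n P).
  by rewrite /midplanes; elim/big_ind : _ => [|A B|i _];
    [exact: measurable0|exact: measurableU|exact: (hyperplane_null n i _).1].
split => //; apply: measure_negligible => //.
rewrite /midplanes; elim/big_ind : _ => [|A B|i _]; [exact: negligible_set0|exact: negligibleU|].
by exists [set x : 'rV[R]_n | x ord0 i = corner P ord0 i + side P / 2]; split => //;
  have [] := hyperplane_null n i (corner P ord0 i + side P / 2).
Qed.

Lemma mem_child n (P : cube R n) (e : 'I_n -> bool) x :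
  (child P e : set 'rV[R]_n) x <-> forall i,
   corner P ord0 i + side P / 2 *+ e i <= x ord0 i <=
     corner P ord0 i + side P / 2 *+ e i + side P / 2.
Proof. by split => h i; have := h i; rewrite /= !mxE. Qed.

Lemma child_subset n (P : cube R n) e : (child P e : set 'rV[R]_n) `<=` P.
Proof.
move=> x /mem_child h i; have := h i; have := side_gt0 P.
case: (e i); rewrite ?mulr1n ?mulr0n => ? /andP[? ?]; apply/andP; split; lra.
Qed.

Lemma cube_children n (P : cube R n) :
  (P : set 'rV[R]_n) = \big[setU/set0]_(e : {ffun 'I_n -> bool}) (child P e : set 'rV[R]_n).
Proof.
rewrite -bigcup_seq; apply/seteqP; split => x /=; last first.
  by move=> [e _]; exact: child_subset.
move=> Px; exists [ffun i => corner P ord0 i + side P / 2 <= x ord0 i] => /=.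
  by rewrite mem_index_enum.
apply/mem_child => i; rewrite ffunE; have := Px i; have := side_gt0 P.
by case: (leP (corner P ord0 i + side P / 2)); rewrite ?mulr1n ?mulr0n => ? ? /andP[? ?];
  apply/andP; split; lra.
Qed.

Lemma child_disjoint n (P : cube R n) (e e' : {ffun 'I_n -> bool}) x : e != e' ->
  (child P e : set 'rV[R]_n) x -> (child P e' : set 'rV[R]_n) x -> midplanes n P x.
Proof.
move=> ee' /mem_child h /mem_child h'.
have [i ei] : exists i, e i != e' i.
  apply/existsP; apply: contraNT ee'; rewrite negb_exists => /forallP eq.
  by apply/eqP/ffunP => i; apply/eqP; have := eq i; rewrite negbK.
rewrite /midplanes -bigcup_seq; exists i => /=; first by rewrite mem_index_enum.
have := h i; have := h' i; move: ei; have := side_gt0 P.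
case: (e i) (e' i) => -[]; rewrite // ?mulr1n ?mulr0n => ? _ /andP[? ?] /andP[? ?]; lra.
Qed.

(** The children are disjoint away from the midplanes, which are null. *)
Lemma integral_children n (P : cube R n) (F : 'rV[R]_n -> \bar R) :
  measurable_fun (P : set (lebesgue_type R n)) F ->
  (forall x, (P : set 'rV[R]_n) x -> 0 <= F x)%E ->
  (\int[mu n]_(x in P) F x = \sum_(e : {ffun 'I_n -> bool}) \int[mu n]_(x in child P e) F x)%E.
Proof.
move=> mF F0; have [mZ Z0] := midplanes_null n P.
have mZ' := borel_lebesgue n _ mZ.
have Z0' : mu n (midplanes n P) = 0%E by rewrite lebesgue_rVE.
have mC Q := borel_lebesgue n _ (measurable_cube n Q).
rewrite (ge0_negligible_integral mZ')//.
rewrite (_ : _ `\` _ =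
    \big[setU/set0]_(e : {ffun 'I_n -> bool}) (child P e `\` midplanes n P)); last first.
  rewrite [X in X `\` _]cube_children !setDE big_distrl/=.
  by apply: eq_bigr => e _; rewrite setDE.
rewrite ge0_integral_bigsetU//=.
- apply: eq_bigr => e _; rewrite -ge0_negligible_integral//.
  + by apply: measurable_funS mF; [exact: mC|exact: child_subset].
  + by move=> x /child_subset /F0.
- by move=> e; apply: measurableD => //; exact: mC.
- exact: index_enum_uniq.
- apply/trivIsetP => e e' _ _ ee'; rewrite -subset0 => x [[ex nx] [e'x _]].
  exact: nx (child_disjoint _ _ _ _ _ ee' ex e'x).
- apply: measurable_funS mF; first exact: mC.
  by rewrite -bigcup_seq => x [e _ [/child_subset]].
- by move=> x; rewrite -bigcup_seq => -[e _ [/child_subset + _]]; exact: F0.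
Qed.

Lemma Rintegral_children n (P : cube R n) (f : 'rV[R]_n -> R) :
  (mu n).-integrable P (EFin \o f) ->
  \int[mu n]_(x in P) f x = \sum_(e : {ffun 'I_n -> bool}) \int[mu n]_(x in child P e) f x.
Proof.
move=> fi; have mC Q := borel_lebesgue n _ (measurable_cube n Q).
have ge0_children (g : 'rV[R]_n -> \bar R) : (mu n).-integrable P g -> (forall x, 0 <= g x)%E ->
    fine (\int[mu n]_(x in P) g x) =
    \sum_(e : {ffun 'I_n -> bool}) fine (\int[mu n]_(x in child P e) g x).
  move=> gi g0; rewrite integral_children//; last by case/integrableP : gi.
  rewrite sum_fine// => e _; apply: integrable_fin_num; first exact: mC.
  by apply: integrableS gi; [exact: mC|exact: mC|exact: child_subset].
have split_fine (Q : cube R n) : (Q : set 'rV[R]_n) `<=` P -> \int[mu n]_(x in Q) f x =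
    fine (\int[mu n]_(x in Q) (EFin \o f)^\+ x) - fine (\int[mu n]_(x in Q) (EFin \o f)^\- x).
  move=> QP; have fiQ : (mu n).-integrable Q (EFin \o f).
    by apply: integrableS fi; [exact: mC|exact: mC|].
  rewrite /Rintegral integralE fineB//; apply: integrable_fin_num; try exact: mC.
    exact: integrable_funepos.
  exact: integrable_funeneg.
rewrite split_fine// !ge0_children//.
- by rewrite -sumrB; apply: eq_bigr => e _; rewrite split_fine//; exact: child_subset.
- by apply: integrable_funeneg => //; exact: mC.
- by apply: integrable_funepos => //; exact: mC.
Qed.

Lemma vol_children n (P : cube R n) :
  vol (P : set 'rV[R]_n) = \sum_(e : {ffun 'I_n -> bool}) vol (child P e : set 'rV[R]_n).
Proof.
rewrite (eq_bigr (fun=> (side P / 2) ^+ n)) => [|e _]; last exact: volE.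
rewrite sumr_const volE [#|_|](card_ffun 'I_n bool) card_bool card_ord.
by rewrite -[RHS]mulr_natl natrX -exprMn; congr (_ ^+ _); field.
Qed.

Lemma dyadic_subset n (Q P : cube R n) : dyadic Q P -> (P : set 'rV[R]_n) `<=` Q.
Proof. by elim=> [//|P' e _ IH] x /child_subset; exact: IH. Qed.

End cubes.

(** * Lipschitz functions of one variable *)

Section lipschitz_FTC.
Context {R : realType}.
Local Notation lambda := (@lebesgue_measure R).

Lemma stieltjes_itv (F : cumulative R R) u v : u <= v ->
  lebesgue_stieltjes_measure F `]u, v]%classic = (F v - F u)%:E.
Proof.
move=> uv; rewrite /lebesgue_stieltjes_measure /measure_extension.
by rewrite measurable_mu_extE/=; [rewrite wlength_itv_bnd|exact: is_ocitv].
Qed.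

Section density.
Variable G : R -> R.
Hypothesis Gnd : nondecreasing G.
Hypothesis idGnd : nondecreasing (fun x => x - G x).

Let G_dist x y : `|G x - G y| <= `|x - y|.
Proof.
wlog xy : x y / x <= y => [h|].
  by case/orP : (le_total x y) => [/h//|/h]; rewrite distrC (distrC x).
have Gxy := Gnd _ _ xy; have := idGnd _ _ xy.
by rewrite !ler0_norm ?subr_le0//; lra.
Qed.

Let Gcont : continuous G.
Proof.
move=> x; apply/cvgrPdist_lt => e e0; near=> y.
apply: le_lt_trans (G_dist _ _) _; near: y; apply/cvgr_dist_lt => //; exact: cvg_id.
Unshelve. all: by end_near. Qed.

Let idGcont : continuous (fun x => x - G x).
Proof. by move=> x; apply: cvgB; [exact: cvg_id|exact: Gcont]. Qed.

(** The Stieltjes measures of [G] and of [id - G] add up to the Lebesgue measure. *)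
Lemma stieltjes_le_lebesgue (Gc : cumulative R R) : (Gc : R -> R) = G ->
  forall A, measurable A -> (lebesgue_stieltjes_measure Gc A <= lambda A)%E.
Proof.
move=> GcE A mA.
pose idG x := x - G x.
pose H : cumulative R R := HB.pack idG
  (isCumulative.Build R _ R idG idGnd (right_continuousW idGcont)).
pose nu1 := lebesgue_stieltjes_measure Gc.
pose nu2 := lebesgue_stieltjes_measure H.
have -> : lambda A = (nu1 A + nu2 A)%E; last by rewrite leeDl.
rewrite -(measure_addE nu1 nu2); apply: lebesgue_measure_unique => //.
move=> X [[u v] _ <-]; apply: etrans (esym (measure_addE nu1 nu2 _)).
have [uv|vu] := leP u v; last first.
  by rewrite /= set_itv_ge ?measure0 ?adde0// bnd_simp -leNgt ltW.
apply: (@etrans _ _ ((G v - G u)%:E + (idG v - idG u)%:E)%E).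
  apply: (etrans (stieltjes_itv idfun u v uv)).
  by rewrite -EFinD; congr EFin => /=; rewrite /idG; ring.
apply/esym; congr (_ + _)%E; last exact: (stieltjes_itv H).
by rewrite -GcE; exact: stieltjes_itv.
Qed.

(** The Stieltjes measure of [G] is dominated by the Lebesgue measure, hence has a
    density by the Radon-Nikodym theorem. *)
Lemma stieltjes_density a b : a < b ->
  exists d : R -> R, lambda.-integrable `]a, b] (EFin \o d) /\
    forall x, a <= x <= b -> G x - G a = \int[lambda]_(t in `]a, x]) d t.
Proof.
move=> ab.
pose Gc : cumulative R R := HB.pack G
  (isCumulative.Build R _ R G Gnd (right_continuousW Gcont)).
pose nu := lebesgue_stieltjes_measure Gc.
have nuE u v : u <= v -> nu `]u, v]%classic = (G v - G u)%:E by exact: (stieltjes_itv Gc).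
have mI : measurable (`]a, b]%classic : set (measurableTypeR R)) by exact: measurable_itv.
have nuoo : (nu `]a, b]%classic < +oo)%E by rewrite nuE ?ltW// ltry.
pose nu' : {finite_measure set (measurableTypeR R) -> \bar R} := mfrestr mI nuoo.
have nu'E A : nu' A = nu (A `&` `]a, b]%classic) by [].
have dom : nu' `<< lambda.
  apply/null_content_dominatesP => A mA A0.
  apply/eqP; rewrite eq_le measure_ge0 andbT nu'E.
  apply: (le_trans (stieltjes_le_lebesgue Gc erefl _ (measurableI _ _ mA mI))).
  by rewrite -[leRHS]A0 le_measure ?inE//; exact: measurableI.
have [f [f0 ffin fint fE]] := radon_nikodym_sigma_finite dom.
exists (fine \o f).
have fineE : EFin \o (fine \o f) = f by apply/funext => x /=; rewrite fineK.
split; first by rewrite fineE; exact: integrableS fint.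
move=> x /andP[ax xb].
rewrite /Rintegral (_ : (fun x => (fine (f x))%:E) = f)// -fE//.
rewrite nu'E setIidl ?nuE//.
by apply: subset_itvl; rewrite bnd_simp.
Qed.

(** At a Lebesgue point of the density, the indefinite integral is derivable. *)
Lemma ae_derivable_density a b : a < b ->
  exists d : R -> R, lambda.-integrable `]a, b] (EFin \o d) /\
    G b - G a = \int[lambda]_(t in `]a, b]) d t /\
    {ae lambda, forall x, x \in `]a, b[ -> derivable G x 1 /\ derive1 G x = d x}.
Proof.
move=> ab; have [d [dint dE]] := stieltjes_density a b ab.
exists d; split => //; split; first by apply: dE; rewrite lexx ltW.
have mI : measurable (`]a, b]%classic : set (measurableTypeR R)) by exact: measurable_itv.
have := integrable_locally mI dint.
move=> /lebesgue_differentiation; apply: filterS; first exact: (ae_filter_ringOfSetsType lambda).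
move=> x xpt; rewrite in_itv/= => /andP[ax xb].
pose F y := \int[lambda]_(t in `]a, y]) (d \_ `]a, b]) t.
have dint' : lambda.-integrable `]a, b] (EFin \o (d \_ `]a, b])).
  apply: eq_integrable dint => // y; rewrite inE/= => yab.
  by rewrite patchE mem_set.
have [dF F'E] := FTC1_lebesgue_pt xb dint' ax xpt.
have GF : {near x, (fun y => F y + G a) =1 G}.
  near=> y.
  have yab : a <= y <= b.
    by apply/andP; split; apply/ltW; near: y; [exact: lt_nbhsr|exact: lt_nbhsl].
  rewrite /F -[RHS](subrK (G a)) dE//; congr (_ + _).
  apply: eq_Rintegral => t; rewrite inE/= in_itv/= => /andP[at_ ty].
  by rewrite patchE mem_set//= in_itv/= at_ (le_trans ty)//; case/andP : yab.
have isd : is_derive x 1 (fun y => F y + G a) (d x).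
  rewrite -[d x]addr0; apply: is_deriveD.
  apply: DeriveDef => //.
  by rewrite -derive1E F'E patchE mem_set//= in_itv/= ax ltW.
have isG : is_derive x 1 G (d x).
  by apply: near_eq_is_derive isd; rewrite ?oner_eq0//; near do exact: esym.
by split; [exact: ex_derive|rewrite derive1E derive_val].
Unshelve. all: by end_near. Qed.

End density.

(** The function [(phi / K + id) / 2] and its difference with the identity are both
    nondecreasing. *)
Lemma lipschitz_FTC (phi : R -> R) (K a b : R) : 0 < K ->
  (forall x y, `|phi x - phi y| <= K * `|x - y|) -> a < b ->
  exists psi : R -> R, lambda.-integrable `]a, b] (EFin \o psi) /\
    phi b - phi a = \int[lambda]_(t in `]a, b]) psi t /\
    {ae lambda, forall x, x \in `]a, b[ -> derivable phi x 1 /\ derive1 phi x = psi x}.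
Proof.
move=> K0 lip ab.
pose G x := (K^-1 * phi x + x) / 2.
have lip' x y : x <= y -> `|K^-1 * phi x - K^-1 * phi y| <= y - x.
  move=> xy; rewrite -mulrBr normrM gtr0_norm ?invr_gt0// mulrC ler_pdivrMr//.
  by rewrite mulrC (le_trans (lip x y))// distrC ger0_norm ?subr_ge0.
have Gnd : nondecreasing G.
  move=> x y xy; have := lip' x y xy; rewrite ler_norml /G; lra.
have idGnd : nondecreasing (fun x => x - G x).
  move=> x y xy; have := lip' x y xy; rewrite ler_norml /G; lra.
have [d [dint [dE dae]]] := ae_derivable_density G Gnd idGnd a b ab.
have mI : measurable (`]a, b]%classic : set (measurableTypeR R)) by exact: measurable_itv.
have phiE : phi = (fun x => K * (2 * G x - x)).
  by apply/funext => x; rewrite /G; field; rewrite gt_eqF.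
have lamI : lambda `]a, b]%classic = (b - a)%:E.
  by rewrite lebesgue_measure_itv/= lte_fin ab -EFinD.
have cint : lambda.-integrable `]a, b] (EFin \o cst (1 : R)).
  apply: measurable_bounded_integrable => //.
    by rewrite [ltLHS]lamI ltry.
  exact: bounded_cst.
have dint2 : lambda.-integrable `]a, b] (EFin \o (fun x => 2 * d x)).
  rewrite (_ : _ \o _ = (fun x => 2%:E * (d x)%:E)%E)//.
  exact: integrableZl.
have dint3 : lambda.-integrable `]a, b] (EFin \o (fun x => 2 * d x - 1)).
  rewrite (_ : _ \o _ = (fun x => (2 * d x)%:E - (cst 1 x)%:E)%E)//.
  exact: integrableB.
exists (fun x => K * (2 * d x - 1)); split; [|split].
- rewrite (_ : _ \o _ = (fun x => K%:E * (2 * d x - 1)%:E)%E)//.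
  exact: integrableZl.
- rewrite RintegralZl// (RintegralB _ dint2 cint)//.
  rewrite RintegralZl// -dE Rintegral_cst//.
  have -> : fine (lambda `]a, b]) = b - a by rewrite -[b - a]/(fine (b - a)%:E); congr fine.
  by rewrite phiE mul1r; ring.
- apply: filterS dae; first exact: (ae_filter_ringOfSetsType lambda).
  move=> x xd xab; have [dG G'] := xd xab.
  have isG : is_derive x 1 G (d x).
    by apply: DeriveDef => //; rewrite -derive1E.
  have isphi : is_derive x 1 phi (K * (2 * d x - 1)).
    rewrite phiE; apply: is_deriveZ.
  by split; [exact: ex_derive|rewrite derive1E derive_val].
Qed.

End lipschitz_FTC.

(** * Directional derivatives of Lipschitz functions *)

Lemma lipschitz_continuous {R : realType} {V W : normedModType R} (F : V -> W) (K : R) :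
  0 < K -> (forall x y, `|F x - F y| <= K * `|x - y|) -> continuous F.
Proof.
move=> K0 FK x; apply/cvgrPdist_lt => e e0; near=> y.
apply: le_lt_trans (FK _ _) _; rewrite mulrC -ltr_pdivlMr//; near: y.
by apply/cvgr_dist_lt; [exact: cvg_id|rewrite divr_gt0].
Unshelve. all: by end_near. Qed.

Lemma quotient_continuous {R : realType} {V : normedModType R} (F : V -> R) (v : V) (h : R) :
  continuous F -> continuous (fun x => h^-1 * (F (h *: v + x) - F x)).
Proof.
move=> cF x; apply: cvgM; first exact: cvg_cst.
apply: cvgB; last exact: cF.
apply: (@continuous_comp _ _ _ (fun x => h *: v + x) F); last exact: cF.
by apply: cvgD; [exact: cvg_cst|exact: cvg_id].
Qed.

Section directional.
Context {R : realType} {n : nat}.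
Local Notation lambda := (@lebesgue_measure R).
Local Notation mu0 := (product_lebesgue R n).
Variables (F : 'rV[R]_n -> R) (K : R) (v : 'rV[R]_n).
Hypothesis K0 : 0 < K.
Hypothesis FK : forall x y, `|F x - F y| <= K * `|x - y|.
Hypothesis v1 : `|v| <= 1.

Let Fcont : continuous F.
Proof. exact: lipschitz_continuous K0 FK. Qed.

Let quot (h : R) (x : 'rV[R]_n) : R := h^-1 * (F (h *: v + x) - F x).

Let quot_cont h : continuous (quot h).
Proof. exact: quotient_continuous Fcont. Qed.

Definition nonderivable : set 'rV[R]_n := [set x | ~ derivable F x v].

(** Setting the derivative to 0 at the points where it does not exist makes it Borel and
    bounded everywhere. *)
Definition derivable_part (x : 'rV[R]_n) : R :=
  ('D_v F \_ (~` nonderivable)) x.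

Let derivableP x : derivable F x v <-> forall m : nat, exists k : nat, forall h h' : R,
  0 < `|h| < k.+1%:R^-1 -> 0 < `|h'| < k.+1%:R^-1 ->
  `|quot h x - quot h' x| <= m.+1%:R^-1.
Proof.
have small (e : R) : 0 < e -> exists k : nat, k.+1%:R^-1 < e.
  move=> e0; have [k _ /(_ k (leqnn k)) ke] := near_infty_natSinv_lt (PosNum e0).
  by exists k.
split.
  move=> /cvg_cauchy/cauchy_ballP cau m.
  have m0 : 0 < m.+1%:R^-1 :> R by rewrite invr_gt0.
  have [[A B] [/= nA nB] AB] := cau _ m0.
  have [d /= d0 dA] := nA; have [d' /= d'0 dB] := nB.
  have [k kd] : exists k : nat, k.+1%:R^-1 < Num.min d d' by apply: small; rewrite lt_min d0.
  move: kd; rewrite lt_min => /andP[kd kd'].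
  exists k => h h' /andP[h0 hk] /andP[h'0 h'k].
  apply/ltW/(AB (quot h x, quot h' x)); split => /=.
    by apply: dA; [rewrite /= sub0r normrN (lt_trans hk)|rewrite -normr_gt0].
  by apply: dB; [rewrite /= sub0r normrN (lt_trans h'k)|rewrite -normr_gt0].
move=> H; apply/cauchy_cvgP/cauchy_ballP => e e0.
have [m me] := small _ e0; have [k kP] := H m.
have k0 : 0 < k.+1%:R^-1 :> R by rewrite invr_gt0.
exists ([set quot h x | h in [set h | 0 < `|h| < k.+1%:R^-1]],
        [set quot h x | h in [set h | 0 < `|h| < k.+1%:R^-1]]) => /=.
  by split; exists k.+1%:R^-1 => //= h; rewrite /ball_/= sub0r normrN => hk hn0;
    exists h => //; rewrite normr_gt0 hn0.
move=> [_ _] /= [[h hk <-] [h' h'k <-]].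
exact: le_lt_trans (kP _ _ hk h'k) me.
Qed.

(** By Cauchy's criterion with bounds of the form [1 / (k + 1)], nonderivability is a
    countable combination of conditions which are open in [x], because for fixed
    increments the difference quotients are continuous in [x]. *)
Lemma measurable_nonderivable : measurable nonderivable.
Proof.
pose U (m k : nat) := \bigcup_(p in [set p : R * R |
   0 < `|p.1| < k.+1%:R^-1 /\ 0 < `|p.2| < k.+1%:R^-1])
   [set x : 'rV[R]_n | m.+1%:R^-1 < `|quot p.1 x - quot p.2 x|].
have -> : nonderivable = \bigcup_m \bigcap_k U m k.
  apply/seteqP; split => x /=.
    move/derivableP => /existsNP[m /forallNP mH]; exists m => // k _.
    have /existsNP[h /existsNP[h']] := mH k.
    move=> /not_implyP[hk /not_implyP[h'k /negP]]; rewrite -ltNge => lt.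
    by exists (h, h').
  move=> [m _ mH] /derivableP /(_ m)[k kP].
  have [[h h'] /= [hk h'k]] := mH k I; rewrite ltNge => /negP; apply.
  exact: kP.
apply: bigcupT_measurable => m; apply: bigcapT_measurable => k.
apply: open_measurable_rV; apply: bigcup_open => -[h h'] _ /=.
rewrite (_ : mkset _ = (fun x => `|quot h x - quot h' x|) @^-1` `]m.+1%:R^-1, +oo[); last first.
  by apply/seteqP; split => x /=; rewrite in_itv/= andbT.
have cq : continuous (fun x => `|quot h x - quot h' x|).
  move=> x; apply: (@continuous_comp _ _ _ (fun x => quot h x - quot h' x) (fun y : R =>
    `|y|)); last exact: norm_continuous.
  exact: (continuousB (@quot_cont h x) (@quot_cont h' x)).
by move/continuousP : cq; apply; exact: rray_open.
Qed.

Lemma measurable_derivable_part : measurable_fun setT (derivable_part : _ -> measurableTypeR R).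
Proof.
have mN := measurable_nonderivable.
apply/(measurable_restrictT _ _).1; first exact: measurableC.
apply: (@measurable_fun_cvg _ _ _ _ (fun k x => quot k.+1%:R^-1 x)).
  by move=> k; apply: measurable_funTS; exact: continuous_measurable_rV.
move=> x /contrapT dx.
have : (fun k : nat => k.+1%:R^-1 : R) @ \oo --> (0 : R)^'.
  move=> A [d /= d0 dA]; have [k _ kd] := near_infty_natSinv_lt (PosNum d0).
  exists k => // j /= kj; apply: dA => /=; last by rewrite invr_eq0.
  by rewrite sub0r normrN ger0_norm ?invr_ge0//; exact: kd.
move=> h0; exact: cvg_trans (cvg_app (fun h => quot h x) h0) dx.
Qed.

Lemma derivable_partE x : derivable F x v -> derivable_part x = 'D_v F x.
Proof. by move=> dx; rewrite /derivable_part patchE mem_set//= => /(_ dx). Qed.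

Lemma derivable_part_bound x : `|derivable_part x| <= K.
Proof.
rewrite /derivable_part patchE; case: ifPn => [|_]; last by rewrite normr0 ltW.
rewrite inE /= => /contrapT dx.
have dx' : quot ^~ x @ 0^' --> 'D_v F x by exact: dx.
have dxn : `|quot h x| @[h --> 0^'] --> `|'D_v F x| by exact: cvg_norm dx'.
rewrite -(cvg_lim _ dxn)//.
apply: limr_le; first by apply/cvg_ex; eexists; exact: dxn.
near=> h.
have h0 : h != 0 by near: h; exact: nbhs_dnbhs_neq.
rewrite /quot normrM normfV mulrC ler_pdivrMr ?normr_gt0//.
apply: le_trans (FK _ _) _; rewrite ler_wpM2l ?(ltW K0)//.
by rewrite addrK normrZ ler_piMr.
Unshelve. all: by end_near. Qed.

Definition line_fun x (t : R) : R := F (x + t *: v).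

Lemma line_fun_quotient x (s : R) :
  (fun h : R => h^-1 *: ((line_fun x \o shift s) (h *: 1) - line_fun x s)) =
  (fun h : R => h^-1 *: ((F \o shift (x + s *: v)) (h *: v) - F (x + s *: v))).
Proof.
apply/funext => h; congr (_ *: (_ - _)); rewrite /= /line_fun.
have -> : (h *: 1 : R) = h by exact: mulr1.
by rewrite scalerDl addrCA.
Qed.

Lemma line_fun_derivable x (s : R) :
  derivable (line_fun x) s 1 <-> derivable F (x + s *: v) v.
Proof. by rewrite /derivable line_fun_quotient. Qed.

Lemma line_fun_derive1 x (s : R) : derive1 (line_fun x) s = 'D_v F (x + s *: v).
Proof. by rewrite derive1E /derive line_fun_quotient. Qed.

Lemma line_fun_lipschitz x (s t : R) : `|line_fun x s - line_fun x t| <= K * `|s - t|.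
Proof.
apply: le_trans (FK _ _) _; rewrite ler_wpM2l ?(ltW K0)//.
by rewrite opprD addrACA subrr add0r -scalerBl normrZ ler_piMr.
Qed.

(** On each line parallel to [v] the function is a Lipschitz function of one variable,
    derivable almost everywhere. *)
Lemma nonderivable_null : mu0 nonderivable = 0%E.
Proof.
have mN := measurable_nonderivable.
apply: (slices_null n _ v mN) => x.
have [psi [_ [_ [A [mA A0 sub]]]]] :=
  lipschitz_FTC (line_fun x) K 0 2 K0 (line_fun_lipschitz x) (ltr0n _ 2).
apply: (subset_measure0 _ mA _ A0).
  have := measurableT_comp (measurable_line n v) (@measurable_pair1 _ _ _ _ x).
  move=> /(_ measurableT _ mN); rewrite setTI => mpre.
  exact: (measurableI _ _ (measurable_itv `]0%R, 1%R]) mpre).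
move=> s /= [s01 Ns]; apply: sub => /= /(_ _)[].
  by move: s01; rewrite !in_itv/= => /andP[-> /le_lt_trans -> //]; rewrite ltr1n.
by move/line_fun_derivable.
Qed.

(** The fundamental theorem of calculus on the segment from [x] to [x + h *: v]. *)
Lemma increment_le_integral x (h : R) : 0 < h ->
  (`|F (x + h *: v) - F x|%:E <=
    \int[lambda]_(s in `]0%R, h]) `|derivable_part (x + (s : R) *: v)%R|%:E)%E.
Proof.
move=> h0.
have [psi [psii [incr psiae]]] := lipschitz_FTC (line_fun x) K 0 h K0 (line_fun_lipschitz x) h0.
have -> : F (x + h *: v) - F x = \int[lambda]_(t in `]0, h]) psi t.
  by rewrite -incr /line_fun scale0r addr0.
have mI : measurable (`]0, h]%classic : set (measurableTypeR R)) by exact: measurable_itv.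
have dline : measurable_fun setT (fun s : measurableTypeR R =>
    derivable_part (x + (s : R) *: v) : measurableTypeR R).
  exact: (measurableT_comp measurable_derivable_part
    (measurableT_comp (measurable_line n v) (@measurable_pair1 _ _ _ _ x))).
rewrite EFin_normr_Rintegral//; apply: le_trans (le_abse_integral _ _ _) _ => //.
  by case/integrableP : psii.
rewrite le_eqVlt; apply/orP; left; apply/eqP.
apply: ge0_ae_eq_integral => //.
- by apply: measurableT_comp => //; case/integrableP : psii.
- apply/measurable_funTS/measurable_EFinP.
  exact: measurableT_comp.
(* The derivative is known on the open interval, while the integral includes [h]. *)
have neq_h : {ae lambda, forall s : measurableTypeR R, s <> h}.
  exists [set h]; split => //; first exact: lebesgue_measure_set1.
  by move=> s /= /contrapT.
have both := @filterI _ _ (ae_filter_ringOfSetsType lambda) _ _ neq_h psiae.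
apply: (@filterS _ _ (ae_filter_ringOfSetsType lambda)) both.
move=> s [sh ds] /=; rewrite in_itv/= => /andP[s0]; rewrite le_eqVlt => /predU1P[//|lt_sh].
have [/line_fun_derivable ds1 ds2] : derivable (line_fun x) s 1 /\ derive1 (line_fun x) s = psi s.
  by apply: ds; rewrite in_itv/= s0.
by rewrite derivable_partE// -line_fun_derive1 ds2.
Qed.

End directional.

(** * Averages over a cube and over its children *)

Section translates.
Context {R : realType} {n : nat}.
Local Notation lambda := (@lebesgue_measure R).
Local Notation mu0 := (product_lebesgue R n).
Local Notation mu := (lebesgue_rV R n).

Lemma integral_lebesgue_rV_signed (D : set 'rV[R]_n) (f : 'rV[R]_n -> \bar R) :
  measurable D -> measurable_fun setT f ->
  (\int[mu]_(x in D) f x = \int[mu0]_(x in D) f x)%E.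
Proof.
move=> mD mf; rewrite integralE [RHS]integralE; congr (_ - _)%E;
  apply: integral_lebesgue_rV => //.
- by apply: measurable_funTS; exact: measurable_funepos.
- by apply: measurable_funTS; exact: measurable_funeneg.
Qed.

Lemma integral_translate_set (D D' : set 'rV[R]_n) (f : 'rV[R]_n -> \bar R) (a : 'rV[R]_n) :
  measurable D -> measurable D' -> (forall x, D x <-> D' (x + a)) ->
  measurable_fun setT f ->
  (\int[mu]_(x in D') f x = \int[mu]_(x in D) f (x + a)%R)%E.
Proof.
move=> mD mD' DD' mf.
have mfa : measurable_fun setT (fun x : 'rV[R]_n => f (x + a)%R).
  exact: (measurableT_comp mf (measurable_addV n a)).
rewrite !integral_lebesgue_rV_signed// integralE.
rewrite [RHS](integralE _ _ (f \o (fun x => x + a)%R)) [in RHS]funepos_comp [in RHS]funeneg_comp.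
have ge0_translate (g : 'rV[R]_n -> \bar R) : measurable_fun setT g -> (forall x, 0 <= g x)%E ->
    (\int[mu0]_(x in D') g x = \int[mu0]_(x in D) g (x + a)%R)%E.
  move=> mg g0; rewrite integral_mkcond [RHS]integral_mkcond.
  rewrite -(integral_translate _ _ a); last 2 first.
  - exact/(measurable_restrictT _ _).1/measurable_funTS.
  - by move=> x; rewrite patchE; case: ifPn.
  apply: eq_integral => x _; rewrite !patchE; congr (if _ then _ else _).
  by apply/idP/idP; rewrite !inE => /DD'.
congr (_ - _)%E.
- rewrite ge0_translate; [by []|exact: measurable_funepos|by []].
- rewrite ge0_translate; [by []|exact: measurable_funeneg|by []].
Qed.

Section increments.
Variables (F : 'rV[R]_n -> R) (K : R) (v : 'rV[R]_n) (B : R).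
Hypothesis K0 : 0 < K.
Hypothesis FK : forall x y, `|F x - F y| <= K * `|x - y|.
Hypothesis v1 : `|v| <= 1.
Hypothesis FB : forall x, `|F x| <= B.

Let mF : measurable_fun setT (F : _ -> measurableTypeR R).
Proof. exact: (continuous_measurable_rV n F (lipschitz_continuous F K K0 FK)). Qed.

Lemma bounded_integrable (D : set 'rV[R]_n) (G : 'rV[R]_n -> R) (c : R) :
  measurable D -> (mu D < +oo)%E -> measurable_fun setT (G : _ -> measurableTypeR R) ->
  (forall x, `|G x| <= c) -> mu.-integrable D (EFin \o G).
Proof.
move=> mD Doo mG Gc; apply: measurable_bounded_integrable => //.
- exact: borel_lebesgue.
- by apply: measurable_fun_lebesgue => //; exact: measurable_funTS.
- exists c; split; first exact: num_real.
  by move=> y cy x _; exact: le_trans (Gc x) (ltW cy).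
Qed.

(** The set [D'] is the translate of [D] by [h *: v], and [P] contains what [D] sweeps on
    the way.  The difference of the integrals is the integral of the increments of
    [F]; they are bounded by integrals along segments, to which [integral_segment]
    applies. *)
Lemma translate_difference_le (D D' P : set 'rV[R]_n) (h : R) :
  measurable D -> measurable D' -> measurable P ->
  (mu D < +oo)%E -> (mu P < +oo)%E -> 0 < h ->
  (forall x, D x <-> D' (x + h *: v)) ->
  (forall x s, D x -> 0 < s <= h -> P (x + s *: v)) ->
  `|\int[mu]_(x in D') F x - \int[mu]_(x in D) F x| <=
  h * \int[mu]_(x in P) `|derivable_part F v x|.
Proof.
move=> mD mD' mP Doo Poo h0 DD' DP.
have md := measurable_derivable_part F K v K0 FK.
have mDl := borel_lebesgue n _ mD.
have mFh : measurable_fun setT (fun x : 'rV[R]_n => F (x + h *: v) : measurableTypeR R).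
  exact: (measurableT_comp mF (measurable_addV n _)).
have iF : mu.-integrable D (EFin \o F) by exact: (bounded_integrable _ _ B).
have iFh : mu.-integrable D (EFin \o (fun x => F (x + h *: v))).
  exact: (bounded_integrable _ _ B).
have id : mu.-integrable P (EFin \o (fun x => `|derivable_part F v x|)).
  apply: (bounded_integrable _ _ K) => //; first exact: measurableT_comp.
  by move=> x; rewrite normr_id; exact: derivable_part_bound.
have -> : \int[mu]_(x in D') F x = \int[mu]_(x in D) F (x + h *: v).
  by rewrite /Rintegral (integral_translate_set _ _ _ _ mD mD' DD')//; exact/measurable_EFinP.
rewrite -RintegralB//.
have mFB : measurable_fun setT (fun x : 'rV[R]_n => F (x + h *: v) - F x : measurableTypeR R).
  exact: measurable_funB.
have iFB : mu.-integrable D (EFin \o (fun x => F (x + h *: v) - F x)).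
  apply: (bounded_integrable _ _ (B + B)) => // x.
  by rewrite (le_trans (ler_normB _ _))// lerD.
apply: le_trans (le_normr_Rintegral _ _) _ => //.
rewrite -lee_fin EFinM /Rintegral !fineK; last 2 first.
- by apply: integrable_fin_num => //; exact: borel_lebesgue.
- by apply: integrable_fin_num => //; exact: integrable_norm.
pose G x : \bar R := `|derivable_part F v x * \1_P x|%:E.
have mG : measurable_fun setT G.
  apply/measurable_EFinP; apply: measurableT_comp => //.
  by apply: (measurable_funM md); exact: measurable_indic.
have G0 x : (0 <= G x)%E by rewrite lee_fin.
have mabs : measurable_fun setT (fun x : 'rV[R]_n => `|F (x + h *: v) - F x|%:E).
  by apply/measurable_EFinP/measurableT_comp.
rewrite integral_lebesgue_rV//; last exact: measurable_funTS.
apply: (@le_trans _ _ (\int[mu0]_x \int[lambda]_(s in `]0%R, h]) G (x + (s : R) *: v)%R)%E).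
  rewrite integral_mkcond; apply: ge0_le_integral => //.
  - by move=> x _; rewrite patchE; case: ifPn => // _; rewrite lee_fin.
  - exact/(measurable_restrictT _ _).1/measurable_funTS.
  - exact: measurable_segment.
  - move=> x _; rewrite patchE; case: ifPn => [|_]; last by apply: integral_ge0.
    rewrite inE => Dx; apply: le_trans (increment_le_integral F K v K0 FK v1 x h h0) _.
    rewrite le_eqVlt; apply/orP; left; apply/eqP.
    apply: eq_integral => s; rewrite inE/= in_itv/= => s0h.
    by rewrite /G indicE mem_set ?mulr1//; exact: DP.
rewrite integral_segment ?(ltW h0)// lee_pmul2l ?lte_fin//.
rewrite integral_lebesgue_rV//; last first.
  by apply/measurable_EFinP/measurable_funTS/measurableT_comp.
rewrite [leRHS]integral_mkcond le_eqVlt; apply/orP; left; apply/eqP.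
apply: eq_integral => x _; rewrite patchE /G indicE.
by case: (x \in P); rewrite ?mulr1// mulr0 normr0.
Qed.

End increments.

End translates.

Lemma rV_norm_le {R : realType} n (x : 'rV[R]_n) (c : R) : 0 <= c ->
  (forall i, `|x ord0 i| <= c) -> `|x| <= c.
Proof.
move=> c0 xc; rewrite (_ : `|x| = \big[Num.max/0]_ij `|x ij.1 ij.2|); last exact: mx_normrE.
by apply: bigmax_le => // -[i j] _ /=; rewrite ord1.
Qed.

Lemma rV_norm_ge {R : realType} n (x : 'rV[R]_n) i : `|x ord0 i| <= `|x|.
Proof.
rewrite [leRHS](_ : `|x| = \big[Num.max/0]_ij `|x ij.1 ij.2|); last exact: mx_normrE.
exact: (le_bigmax _ (fun ij : 'I_1 * 'I_n => `|x ij.1 ij.2|) (ord0, i)).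
Qed.

(** The coordinates of [e] are changed into those of [e'] one at a time. *)
Lemma hypercube_path {R : realType} n (A : {ffun 'I_n -> bool} -> R) (delta : R) :
  (forall (e : {ffun 'I_n -> bool}) i, `|A [ffun j => if j == i then true else e j] -
                 A [ffun j => if j == i then false else e j]| <= delta) ->
  forall e e', `|A e - A e'| <= n%:R * delta.
Proof.
move=> adj e e'.
pose mix k := [ffun j : 'I_n => if (j < k)%N then e' j else e j].
have step (i : 'I_n) : `|A (mix i) - A (mix i.+1)| <= delta.
  pose T := [ffun j => if j == i then true else mix i j].
  pose F := [ffun j => if j == i then false else mix i j].
  have TF : `|A T - A F| <= delta by exact: adj.
  have delta0 : 0 <= delta := le_trans (normr_ge0 _) TF.
  have mixE (k : nat) : (k = i \/ k = i.+1) -> mix k = T \/ mix k = F.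
    move=> ki; have eqk j : j != i -> mix k j = mix i j.
      move=> ji; rewrite !ffunE; case: ki => -> //.
      by rewrite ltnS leq_eqVlt val_eqE (negbTE ji).
    case E : (mix k i); [left|right]; apply/ffunP => j; rewrite [RHS]ffunE;
      by case: (eqVneq j i) => [->//|]; exact: eqk.
  have [->|->] := mixE i (or_introl erefl); have [->|->] := mixE i.+1 (or_intror erefl);
    by rewrite ?subrr ?normr0// distrC.
have path k : (k <= n)%N -> `|A (mix 0) - A (mix k)| <= k%:R * delta.
  elim: k => [|k IH] kn; first by rewrite subrr normr0 mul0r.
  rewrite -addn1 natrD mulrDl mul1r addn1.
  apply: le_trans (ler_distD (A (mix k)) _ _) _.
  by apply: lerD; [exact: IH (ltnW kn)|exact: (step (Ordinal kn))].
have -> : e = mix 0 by apply/ffunP => j; rewrite ffunE.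
have -> : e' = mix n by apply/ffunP => j; rewrite ffunE ltn_ord.
exact: path.
Qed.

Section poincare.
Context {R : realType} {n : nat}.
Local Notation mu := (lebesgue_rV R n).
Variables (F : 'rV[R]_n -> R) (K : R) (B : R).
Hypothesis K0 : 0 < K.
Hypothesis FK : forall x y, `|F x - F y| <= K * `|x - y|.
Hypothesis FB : forall x, `|F x| <= B.

Local Notation unitv i := (delta_mx ord0 i : 'rV[R]_n).

Lemma unitv_norm i : `|unitv i| <= 1.
Proof.
apply: rV_norm_le => // j; rewrite mxE eqxx /=.
by case: eqP => _; rewrite ?normr1 ?normr0.
Qed.

Definition grad_part (x : 'rV[R]_n) : 'rV[R]_n := \row_i derivable_part F (unitv i) x.

Lemma measurable_grad_part :
  measurable_fun setT (fun x => enorm (grad_part x) : measurableTypeR R).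
Proof.
have msqrt : measurable_fun [set: measurableTypeR R] (Num.sqrt : R -> measurableTypeR R).
  exact: (continuous_measurable_fun (@sqrt_continuous R)).
apply: (measurableT_comp msqrt).
apply: measurable_sum => i; apply: measurable_funX.
under eq_fun do rewrite mxE.
exact: measurable_derivable_part K0 FK.
Qed.

Lemma enorm_ge_coord (x : 'rV[R]_n) i : `|x ord0 i| <= enorm x.
Proof.
rewrite /enorm -sqrtr_sqr ler_wsqrtr// (bigD1 i)//= lerDl sumr_ge0// => j _.
exact: sqr_ge0.
Qed.

Lemma grad_part_bound x : `|enorm (grad_part x)| <= Num.sqrt (n%:R * K ^+ 2).
Proof.
rewrite ger0_norm ?sqrtr_ge0// /enorm ler_wsqrtr//.
rewrite -[n in n%:R]card_ord mulr_natl -sumr_const; apply: ler_sum => i _.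
rewrite mxE -real_normK ?num_real// lerXn2r ?nnegrE ?(ltW K0)//.
exact: derivable_part_bound K0 FK (unitv_norm i) x.
Qed.

Definition cube_average (P : cube R n) : R :=
  (vol (P : set 'rV[R]_n))^-1 * \int[mu]_(x in P) F x.

Lemma lebesgue_cube_lty (P : cube R n) : (mu P < +oo)%E.
Proof. by rewrite lebesgue_cube ltry. Qed.

Lemma grad_part_integrable (P : cube R n) :
  mu.-integrable P (EFin \o (fun x => enorm (grad_part x))).
Proof.
apply: bounded_integrable; [exact: measurable_cube|exact: lebesgue_cube_lty|
  exact: measurable_grad_part|exact: grad_part_bound].
Qed.

(** The two children are translates of each other by half a side; the factor [2 ^+ n] is
    the ratio of the volumes of [P] and of a child. *)
Lemma adjacent_children_le (P : cube R n) (e : {ffun 'I_n -> bool}) i :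
  `|cube_average (child P [ffun j => if j == i then true else e j]) -
    cube_average (child P [ffun j => if j == i then false else e j])| <=
  2 ^+ n / 2 * (side P * (\int[mu]_(x in P) enorm (grad_part x) / vol (P : set 'rV[R]_n))).
Proof.
have s0 := side_gt0 P; have h0 : 0 < side P / 2 by rewrite divr_gt0.
set D' := child P _; set D := child P _; rewrite /cube_average.
have volD : vol (D : set 'rV[R]_n) = vol (P : set 'rV[R]_n) / 2 ^+ n.
  by rewrite !volE /= expr_div_n.
have volD' : vol (D' : set 'rV[R]_n) = vol (P : set 'rV[R]_n) / 2 ^+ n.
  by rewrite !volE /= expr_div_n.
rewrite volD volD' -mulrBr normrM gtr0_norm; last by rewrite invr_gt0 divr_gt0 ?vol_gt0
  ?exprn_gt0.
have coordD x (s : R) j : (x + s *: unitv i) ord0 j = x ord0 j + s *+ (j == i).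
  by rewrite !mxE eqxx /=; case: eqP => _; rewrite ?mulr1 ?mulr0.
have := @translate_difference_le R n F K (unitv i) B K0 FK (unitv_norm i) FB
  D D' P (side P / 2) (measurable_cube n D) (measurable_cube n D') (measurable_cube n P)
  (lebesgue_cube_lty D) (lebesgue_cube_lty P) h0.
have DD' x : (D : set 'rV[R]_n) x <-> (D' : set 'rV[R]_n) (x + side P / 2 *: unitv i).
  split => /mem_child H; apply/mem_child => j; have := H j;
    rewrite !ffunE coordD; case: eqP => _;
    rewrite ?mulr1n ?mulr0n ?addr0// => /andP[? ?]; apply/andP; split; lra.
have DP x s : (D : set 'rV[R]_n) x -> 0 < s <= side P / 2 ->
  (P : set 'rV[R]_n) (x + s *: unitv i).
  move=> /mem_child H /andP[sp sh] j; have := H j; rewrite !ffunE coordD.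
  by case: eqP => _; [|case: (e j)]; rewrite ?mulr1n ?mulr0n ?addr0 => /andP[? ?]; apply/andP;
    split; lra.
move=> /(_ DD' DP) le1.
have le2 : \int[mu]_(x in P) `|derivable_part F (unitv i) x| <=
  \int[mu]_(x in P) enorm (grad_part x).
  apply: le_Rintegral.
  - exact: borel_lebesgue (measurable_cube n P).
  - apply: (bounded_integrable _ _ K).
    + exact: measurable_cube.
    + exact: lebesgue_cube_lty.
    + by apply: measurableT_comp => //; exact: measurable_derivable_part K0 FK.
    + by move=> x; rewrite normr_id; exact: derivable_part_bound K0 FK (unitv_norm i) x.
  - exact: grad_part_integrable.
  - by move=> x _; have := enorm_ge_coord (grad_part x) i; rewrite mxE.
set I := \int[mu]_(x in P) enorm _ in le2 *.
apply: (@le_trans _ _ ((vol (P : set 'rV[R]_n) / 2 ^+ n)^-1 * (side P / 2 * I))).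
  rewrite ler_wpM2l ?invr_ge0 ?divr_ge0 ?(ltW (vol_gt0 _ _)) ?exprn_ge0//.
  by apply: le_trans le1 _; rewrite ler_wpM2l// ltW.
rewrite le_eqVlt; apply/orP; left; apply/eqP.
by field; rewrite !gt_eqF ?vol_gt0 ?exprn_gt0.
Qed.

Definition poincare_cst : R := n%:R * (2 ^+ n / 2).

(** The average over [P] is the mean of the averages over the children, and any two
    children are linked by at most [n] steps between adjacent ones. *)
Lemma child_average_le (P : cube R n) (e : {ffun 'I_n -> bool}) :
  `|cube_average (child P e) - cube_average P| <=
  poincare_cst * (side P * (\int[mu]_(x in P) enorm (grad_part x) / vol (P : set 'rV[R]_n))).
Proof.
have path := hypercube_path n (fun e => cube_average (child P e)) _ (adjacent_children_le P).
rewrite /poincare_cst -mulrA; set delta := n%:R * _ in path *.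
have vP := vol_gt0 n P.
have iF : mu.-integrable P (EFin \o F).
  apply: (bounded_integrable _ _ B) => //; [exact: measurable_cube|exact: lebesgue_cube_lty|].
  exact: (continuous_measurable_rV n F (lipschitz_continuous F K K0 FK)).
have sumF := Rintegral_children n P F iF.
have vF (P' : cube R n) : vol (P' : set 'rV[R]_n) * cube_average P' =
    \int[mu]_(x in P') F x.
  by rewrite /cube_average mulrA divff ?mul1r// gt_eqF ?vol_gt0.
have -> : cube_average (child P e) - cube_average P = (vol (P : set 'rV[R]_n))^-1 *
    \sum_(e' : {ffun 'I_n -> bool}) vol (child P e' : set 'rV[R]_n) *
      (cube_average (child P e) - cube_average (child P e')).
  under eq_bigr do rewrite mulrBr vF.
  by rewrite sumrB -mulr_suml -vol_children -sumF -(vF P); field; rewrite gt_eqF.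
rewrite normrM gtr0_norm ?invr_gt0// mulrC ler_pdivrMr//.
apply: le_trans (ler_norm_sum _ _ _) _.
rewrite [in leRHS]vol_children mulr_sumr; apply: ler_sum => e' _.
by rewrite normrM gtr0_norm ?vol_gt0// mulrC ler_pM2r ?vol_gt0.
Qed.

End poincare.

(** * Integral inequalities *)

Section integral_inequalities.
Context d (T : measurableType d) (R : realType) (mu : {measure set T -> \bar R}).
Variable D : set T.
Hypothesis mD : measurable D.
Implicit Types f g : T -> R.

Lemma integrable_dominated f g : measurable_fun D f ->
  (forall x, D x -> `|f x| <= g x) -> mu.-integrable D (EFin \o g) ->
  mu.-integrable D (EFin \o f).
Proof.
move=> mf fg; apply: le_integrable => //; first exact/measurable_EFinP.
move=> x Dx; rewrite /= lee_fin; apply: le_trans (fg x Dx) _; exact: ler_norm.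
Qed.

Lemma integrableDr f g : mu.-integrable D (EFin \o f) -> mu.-integrable D (EFin \o g) ->
  mu.-integrable D (EFin \o (fun x => f x + g x)).
Proof. exact: integrableD. Qed.

Lemma integrableZr_real c f : mu.-integrable D (EFin \o f) ->
  mu.-integrable D (EFin \o (fun x => c * f x)).
Proof. exact: integrableZl. Qed.

Lemma measurable_fun_powR f a : measurable_fun D f -> measurable_fun D (fun x => f x `^ a).
Proof. by move=> mf; apply: (measurableT_comp (measurable_powR a)). Qed.

Lemma measurable_fun_normM f g : measurable_fun D f -> measurable_fun D g ->
  measurable_fun D (fun x => `|f x| * g x).
Proof. by move=> mf mg; apply: measurable_funM => //; exact: measurableT_comp. Qed.

Lemma powR_rootK x a : 0 <= x -> 0 < a -> (x `^ a^-1) `^ a = x :> R.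
Proof. by move=> x0 a0; rewrite -powRrM mulVf ?gt_eqF// powRr1. Qed.

Lemma powR_le_1D x s p : 0 <= x -> 0 <= s <= p -> x `^ s <= 1 + x `^ p :> R.
Proof.
move=> x0 /andP[s0 sp]; have [x1|x1] := leP x 1.
  rewrite -[x `^ s]addr0 lerD ?powR_ge0//.
  have <- : 1 `^ s = 1 :> R by rewrite powR1.
  by rewrite ge0_ler_powR ?nnegrE.
by rewrite -[leLHS]add0r lerD// ler_powR// ltW.
Qed.

(** On a set of finite measure, compare with [1 + f `^ p]. *)
Lemma integrable_powR_le f s p : (mu D < +oo)%E -> measurable_fun D f ->
  (forall x, D x -> 0 <= f x) -> 0 <= s <= p ->
  mu.-integrable D (EFin \o (fun x => f x `^ p)) ->
  mu.-integrable D (EFin \o (fun x => f x `^ s)).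
Proof.
move=> Doo mf f0 sp ifp.
have i1 : mu.-integrable D (EFin \o (fun=> 1 : R)).
  by apply: measurable_bounded_integrable => //; exact: bounded_cst.
apply: integrable_dominated (integrableDr _ _ i1 ifp); first exact: measurable_fun_powR.
by move=> x Dx; rewrite ger0_norm ?powR_ge0// powR_le_1D// f0.
Qed.

(** Integrate the tangent line of the power at the mean [tau], given by
    [powR_perspective_tangent] with [M = 1]. *)
Lemma jensen_powR f a : 1 < a -> 0 < fine (mu D) -> (mu D < +oo)%E ->
  (forall x, D x -> 0 <= f x) -> mu.-integrable D (EFin \o f) ->
  mu.-integrable D (EFin \o (fun x => f x `^ a)) ->
  fine (mu D) * (\int[mu]_(x in D) f x / fine (mu D)) `^ a <=
  \int[mu]_(x in D) f x `^ a.
Proof.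
move=> a1 M0 Doo f0 fi fai; set M := fine (mu D) in M0 *.
set tau := _ / M.
have tau0 : 0 <= tau by rewrite divr_ge0 ?(ltW M0)// Rintegral_ge0.
have i1 : mu.-integrable D (EFin \o (fun=> (a - 1) * tau `^ a : R)).
  by apply: measurable_bounded_integrable => //; exact: bounded_cst.
have i2 := integrableZr_real (a * tau `^ (a - 1)) f fi.
have i3 := integrableB mD i2 i1.
apply: (@le_trans _ _ (\int[mu]_(x in D) (a * tau `^ (a - 1) * f x - (a - 1) * tau `^ a))).
  rewrite RintegralB// RintegralZl// Rintegral_cst// -/M.
  have -> : \int[mu]_(x in D) f x = tau * M by rewrite /tau divfK// gt_eqF.
  have -> : a * tau `^ (a - 1) * (tau * M) = a * (tau * tau `^ (a - 1)) * M by ring.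
  rewrite mulr_powRB1// ?(lt_trans _ a1)//.
  by rewrite le_eqVlt; apply/orP; left; apply/eqP; ring.
apply: le_Rintegral => // x Dx.
have := powR_perspective_tangent a (f x) 1 tau a1 (f0 x Dx) ltr01 tau0.
by rewrite powR1 divr1 mulr1 mulrAC.
Qed.

(** Adding [e] to both factors allows for a division by them when one of them vanishes. *)
Lemma ler_mul_limit (x y z : R) : 0 <= x -> 0 <= y ->
  (forall e, 0 < e -> z <= (x + e) * (y + e)) -> z <= x * y.
Proof.
move=> x0 y0 H; apply/ler_addgt0Pr => e e0.
pose c := x + y + 1; have c0 : 0 < c by rewrite /c; lra.
(* With [u <= 1], [(x + u) * (y + u) <= x * y + u * c]. *)
pose u := Num.min 1 (e / c).
have u0 : 0 < u by rewrite lt_min ltr01 divr_gt0.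
have u1 : u <= 1 by rewrite ge_min lexx.
have uc : u * c <= e by rewrite -ler_pdivlMr// ge_min lexx orbT.
apply: le_trans (H u u0) _.
have : u * u <= u * 1 by rewrite ler_pM2l.
move: uc; rewrite /c; nra.
Qed.

(** Young's inequality for the two functions normalised by [x'] and [y'], which exceed the
    norms by [e] so as to be positive. *)
Lemma hoelder_Rintegral f g a b : 0 < a -> 0 < b -> a^-1 + b^-1 = 1 ->
  measurable_fun D f -> measurable_fun D g ->
  (forall x, D x -> 0 <= f x) -> (forall x, D x -> 0 <= g x) ->
  mu.-integrable D (EFin \o (fun x => f x `^ a)) ->
  mu.-integrable D (EFin \o (fun x => g x `^ b)) ->
  mu.-integrable D (EFin \o (fun x => f x * g x)) /\
  \int[mu]_(x in D) (f x * g x) <=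
    (\int[mu]_(x in D) f x `^ a) `^ a^-1 * (\int[mu]_(x in D) g x `^ b) `^ b^-1.
Proof.
move=> a0 b0 ab mf mg f0 g0 fi gi.
have mfg : measurable_fun D (fun x => f x * g x) by exact: measurable_funM.
have ifg : mu.-integrable D (EFin \o (fun x => f x * g x)).
  apply: integrable_dominated mfg _
    (integrableDr _ _ (integrableZr_real a^-1 _ fi) (integrableZr_real b^-1 _ gi)).
  move=> x Dx; rewrite ger0_norm ?mulr_ge0 ?f0 ?g0//.
  by rewrite mulrC [b^-1 * _]mulrC mulrC [a^-1 * _]mulrC; apply: conjugate_powR; rewrite ?f0 ?g0.
split => //; apply: ler_mul_limit; rewrite ?powR_ge0// => e e0.
have [X XE] : exists X, X = \int[mu]_(x in D) f x `^ a by eexists.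
have [Y YE] : exists Y, Y = \int[mu]_(x in D) g x `^ b by eexists.
have X0 : 0 <= X by rewrite XE; apply: Rintegral_ge0 => x _; exact: powR_ge0.
have Y0 : 0 <= Y by rewrite YE; apply: Rintegral_ge0 => x _; exact: powR_ge0.
rewrite -XE -YE.
have [x' x'E] : exists x', x' = X `^ a^-1 + e by eexists.
have [y' y'E] : exists y', y' = Y `^ b^-1 + e by eexists.
rewrite -x'E -y'E.
have x'0 : 0 < x' by rewrite x'E ltr_wpDl ?powR_ge0.
have y'0 : 0 < y' by rewrite y'E ltr_wpDl ?powR_ge0.
have Xx' : X <= x' `^ a.
  rewrite -[leLHS](powR_rootK X a X0 a0).
  apply: (ge0_ler_powR (ltW a0)); rewrite ?nnegrE ?powR_ge0 ?(ltW x'0)//.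
  by rewrite x'E lerDl ltW.
have Yy' : Y <= y' `^ b.
  rewrite -[leLHS](powR_rootK Y b Y0 b0).
  apply: (ge0_ler_powR (ltW b0)); rewrite ?nnegrE ?powR_ge0 ?(ltW y'0)//.
  by rewrite y'E lerDl ltW.
pose c1 := x' * y' / (a * x' `^ a); pose c2 := x' * y' / (b * y' `^ b).
have c10 : 0 <= c1 by rewrite divr_ge0 ?mulr_ge0 ?powR_ge0 ?ltW.
have c20 : 0 <= c2 by rewrite divr_ge0 ?mulr_ge0 ?powR_ge0 ?ltW.
have i1 := integrableZr_real c1 _ fi; have i2 := integrableZr_real c2 _ gi.
apply: (@le_trans _ _ (\int[mu]_(x in D) (c1 * f x `^ a + c2 * g x `^ b))).
  apply: le_Rintegral => //; first exact: integrableDr.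
  move=> x Dx; have fx := f0 x Dx; have gx := g0 x Dx.
  have := @conjugate_powR R (f x / x') (g x / y') a b (divr_ge0 fx (ltW x'0)) (divr_ge0 gx (ltW
    y'0)) a0 b0 ab.
  rewrite !powR_div ?(ltW x'0) ?(ltW y'0)// => young.
  have := ler_wpM2l (mulr_ge0 (ltW x'0) (ltW y'0)) young.
  have xa : 0 < x' `^ a by exact: powR_gt0.
  have yb : 0 < y' `^ b by exact: powR_gt0.
  congr (_ <= _).
    by field; rewrite !gt_eqF.
  by rewrite /c1 /c2; field; rewrite !gt_eqF.
rewrite RintegralD// !RintegralZl// -XE -YE.
apply: (@le_trans _ _ (c1 * x' `^ a + c2 * y' `^ b)).
  by apply: lerD; rewrite ler_wpM2l.
rewrite le_eqVlt; apply/orP; left; apply/eqP; rewrite /c1 /c2.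
rewrite -[RHS]mulr1 -ab; field.
by rewrite !gt_eqF ?powR_gt0.
Qed.

End integral_inequalities.

(** * Weights *)

Lemma integral_gt0 d (T : measurableType d) (R : realType) (mu : {measure set T -> \bar R})
    (D : set T) (f : T -> R) : measurable D -> (0 < mu D)%E -> measurable_fun D f ->
  (forall x, D x -> 0 <= f x) -> {ae mu, forall x, D x -> 0 < f x} ->
  (0 < \int[mu]_(x in D) (f x)%:E)%E.
Proof.
move=> mD D0 mf f0 fpos; rewrite lt_neqAle integral_ge0 ?andbT => [|x Dx]; last first.
  by rewrite lee_fin f0.
apply/negP => /eqP/esym int0.
have := (ae_eq_integral_abs mu mD ((measurable_EFinP _ _).2 mf)).1.
have -> : (\int[mu]_(x in D) `|(EFin \o f) x| = 0)%E.
  by rewrite -int0; apply: eq_integral => x; rewrite inE => Dx; rewrite /= ger0_norm ?f0.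
move=> /(_ erefl) fzero.
suff : mu D = 0%E by move=> mD0; rewrite mD0 ltxx in D0.
have := filterI fpos fzero.
move=> [N [mN N0 sub]].
apply: (subset_measure0 mD mN _ N0) => x Dx; apply: sub => /= -[/(_ Dx) fx /(_ Dx) [fx0]].
by rewrite fx0 ltxx in fx.
Qed.

Lemma poweR_mul_fin {R : realType} (c al be : R) (x y : \bar R) :
  0 < c -> 0 < al -> 0 < be -> (0 < x)%E -> (0 < y)%E ->
  (c%:E * x `^ al * y `^ be < +oo)%E -> x \is a fin_num /\ y \is a fin_num.
Proof.
move=> c0 al0 be0.
have ale : al != 0 by rewrite gt_eqF.
have bee : be != 0 by rewrite gt_eqF.
case: x => [x| |]//; case: y => [y| |]//; rewrite ?lte_fin => x0 y0.
- by rewrite poweRyr// poweR_EFin -EFinM gt0_muley ?ltxx// lte_fin mulr_gt0// powR_gt0.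
- by rewrite poweRyr// gt0_muley// poweR_EFin gt0_mulye ?ltxx// lte_fin powR_gt0.
- by rewrite !poweRyr// -muleA mulyy gt0_muley ?ltxx.
Qed.

Section muckenhoupt.
Context {R : realType} {n : nat}.
Local Notation mu := (lebesgue_rV R n).
Implicit Types (Q P : cube R n).

Lemma compact_cube Q : compact (Q : set 'rV[R]_n).
Proof.
apply: (@rV_compact R n (fun i => `[corner Q ord0 i, corner Q ord0 i + side Q]%classic)) => i.
exact: segment_compact.
Qed.

Lemma weight_integrable Q w : is_weight Q w -> mu.-integrable Q (EFin \o w).
Proof. by move=> [wi _]; apply: wi => //; exact: compact_cube. Qed.

Lemma measurable_weight Q w : is_weight Q w ->
  measurable_fun (Q : set (lebesgue_type R n)) (w : _ -> R).
Proof. by move=> /weight_integrable/integrableP[/measurable_EFinP]. Qed.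

Lemma weight_powR_gt0 Q w P a : is_weight Q w -> (P : set 'rV[R]_n) `<=` Q ->
  (0 < avg P (fun x => (w x `^ a)%:E))%E.
Proof.
move=> Qw PQ; rewrite /avg mule_gt0 ?lte_fin ?invr_gt0 ?vol_gt0//.
have mC Q' := borel_lebesgue n _ (measurable_cube n Q').
apply: (@integral_gt0 _ _ _ mu).
- exact: mC.
- by rewrite [ltRHS]lebesgue_cube lte_fin exprn_gt0// side_gt0.
- exact/measurable_fun_powR/(measurable_funS (mC Q) PQ (measurable_weight _ _ Qw)).
- by move=> x _; exact: powR_ge0.
- by case: Qw => _; apply: (@filterS _ _ (ae_filter_ringOfSetsType mu)) => x wx /PQ /wx[wx0 _];
    exact: powR_gt0.
Qed.

(** A finite characteristic makes both means finite, since neither of them vanishes; its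
    bound then becomes an inequality between real numbers. *)
Lemma A_class_dyadic (p q r s : R) Q w v P : 1 < p -> 0 < q -> 0 < r -> 0 < s ->
  A_class p q r s Q w v -> dyadic Q P ->
  [/\ mu.-integrable P (EFin \o (fun x => w x `^ (- (conj_exp p * r)))),
      mu.-integrable P (EFin \o (fun x => v x `^ (q * s))) &
      side P / vol (P : set 'rV[R]_n) `^ (p^-1 - q^-1) *
      ((vol (P : set 'rV[R]_n))^-1 *
         \int[mu]_(x in P) w x `^ (- (conj_exp p * r))) `^ (conj_exp p * r)^-1 *
      ((vol (P : set 'rV[R]_n))^-1 * \int[mu]_(x in P) v x `^ (q * s)) `^ (q * s)^-1
      <= fine (A_char p q r s Q w v) ].
Proof.
move=> p1 q0 r0 s0 [Qw Qv Aoo] QP.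
have PQ := dyadic_subset n Q P QP.
have mC Q' := borel_lebesgue n _ (measurable_cube n Q').
have a0 : 0 < conj_exp p * r by rewrite mulr_gt0// divr_gt0 ?subr_gt0// (lt_trans _ p1).
have b0 : 0 < q * s by rewrite mulr_gt0.
set a := conj_exp p * r in a0 *; set b := q * s in b0 *.
have c0 : 0 < side P / vol (P : set 'rV[R]_n) `^ (p^-1 - q^-1).
  by rewrite divr_gt0 ?side_gt0 ?powR_gt0 ?vol_gt0.
set c := _ / _ in c0 *.
have x0 := weight_powR_gt0 Q w P (- a) Qw PQ.
have y0 := weight_powR_gt0 Q v P b Qv PQ.
have leA : (c%:E * avg P (fun x => (w x `^ (- a))%:E) `^ a^-1 *
   avg P (fun x => (v x `^ b)%:E) `^ b^-1 <= A_char p q r s Q w v)%E.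
  by apply: ereal_sup_ubound; exists P.
have [xf yf] := poweR_mul_fin c a^-1 b^-1 _ _ c0 ltac:(by rewrite invr_gt0) ltac:(by rewrite
  invr_gt0)
  x0 y0 (le_lt_trans leA Aoo).
have fin_integrable (u : 'rV[R]_n -> R) : measurable_fun (P : set (lebesgue_type R n)) u ->
    (forall x, 0 <= u x) -> avg P (EFin \o u) \is a fin_num ->
    mu.-integrable P (EFin \o u) /\
    avg P (EFin \o u) = ((vol (P : set 'rV[R]_n))^-1 * \int[mu]_(x in P) u x)%:E.
  move=> mu_ u0 uf.
  have iu : (\int[mu]_(x in P) (u x)%:E)%E \is a fin_num.
    have i0 : (0 <= \int[mu]_(x in P) (u x)%:E)%E by apply: integral_ge0 => x _; rewrite lee_fin.
    rewrite ge0_fin_numE//; rewrite ltey; apply/eqP => iy.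
    by move: uf; rewrite /avg /= iy gt0_muley// lte_fin invr_gt0 vol_gt0.
  split; last by rewrite /avg /= -[in LHS](fineK iu).
  apply/integrableP; split; first exact/measurable_EFinP.
  under eq_integral => x _ do rewrite /= ger0_norm//.
  by rewrite -ge0_fin_numE// integral_ge0// => x _; rewrite lee_fin.
have mP (u : 'rV[R]_n -> R) e : is_weight Q u ->
    measurable_fun (P : set (lebesgue_type R n)) (fun x => u x `^ e).
  by move=> Qu; exact/measurable_fun_powR/(measurable_funS (mC Q) PQ (measurable_weight _ _ Qu)).
have [wi wE] := fin_integrable _ (mP w (- a) Qw) (fun x => powR_ge0 _ _) xf.
have [vi vE] := fin_integrable _ (mP v b Qv) (fun x => powR_ge0 _ _) yf.
split => //.
have Af : A_char p q r s Q w v \is a fin_num.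
  rewrite ge0_fin_numE//; apply: le_trans leA.
  by rewrite !mule_ge0 ?poweR_ge0// lee_fin ltW.
rewrite -lee_fin fineK//; apply: le_trans leA.
by rewrite [avg P _]wE [avg P _]vE !poweR_EFin -!EFinM.
Qed.

End muckenhoupt.

(** * The weighted bound of the tree sum *)

Section ae_Rintegral.
Context d (T : measurableType d) (R : realType) (mu : {measure set T -> \bar R}).
Variable D : set T.
Hypothesis mD : measurable D.
Variables f g : T -> R.
Hypothesis mg : measurable_fun D g.
Hypothesis fg : {ae mu, forall x, D x -> f x = g x}.

Lemma ae_integrable : mu.-integrable D (EFin \o f) -> mu.-integrable D (EFin \o g).
Proof.
move=> fi; have [mf foo] := integrableP _ _ _ fi; apply/integrableP; split;
  first exact/measurable_EFinP.
rewrite (le_lt_trans _ foo)// le_eqVlt; apply/orP; left; apply/eqP.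
apply: ge0_ae_eq_integral => //.
- by apply: measurableT_comp => //; exact/measurable_EFinP.
- exact: measurableT_comp.
- by apply: (@filterS _ _ (ae_filter_ringOfSetsType mu)) fg => x /[apply] /= ->.
Qed.

Lemma ae_eq_Rintegral : measurable_fun D f ->
  \int[mu]_(x in D) f x = \int[mu]_(x in D) g x.
Proof.
move=> mf; rewrite /Rintegral; congr fine; apply: ae_eq_integral => //;
  try exact/measurable_EFinP.
by apply: (@filterS _ _ (ae_filter_ringOfSetsType mu)) fg => x /[apply] /= ->.
Qed.

End ae_Rintegral.

(** This is the bound of one term of the tree sum: [W] and [V] stand for the integrals of
    the powers of the weights, [X] and [Y] for those of the functions, [m] for the
    volume.  When the integrals are rewritten as means, the powers of [m] combine by
    [s^-1 + a^-1 = 1] and [b^-1 + t^-1 = 1]. *)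
Lemma hoelder_key {R : realType} (m side gam nu X Y W V A p q a b s t : R) :
  0 < m -> 0 <= side -> 0 <= gam -> 0 <= X -> 0 <= Y -> 0 <= W -> 0 <= V -> 0 <= A ->
  s^-1 + a^-1 = 1 -> b^-1 + t^-1 = 1 ->
  gam <= X `^ s^-1 * W `^ a^-1 -> nu <= V `^ b^-1 * Y `^ t^-1 ->
  side / m `^ (p^-1 - q^-1) * (m^-1 * W) `^ a^-1 * (m^-1 * V) `^ b^-1 <= A ->
  side * (gam / m) * nu <=
  A * ((m `^ p^-1 * (X / m) `^ s^-1) * (m `^ (1 - q^-1) * (Y / m) `^ t^-1)).
Proof.
move=> m0 side0 gam0 X0 Y0 W0 V0 A0 sa bt gamle nule Ale.
have scale (Z e : R) : 0 <= Z -> Z `^ e = (Z / m) `^ e * m `^ e.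
  by move=> Z0; rewrite -powRM ?divr_ge0 ?(ltW m0)// divfK// gt_eqF.
have mD (e e' : R) : e + e' = 1 -> m `^ e * m `^ e' = m.
  by move=> ee; rewrite -powRD ?ee ?powRr1 ?(ltW m0)// (gt_eqF m0) implybT.
have mid0 : m `^ (p^-1 - q^-1) * m = m `^ p^-1 * m `^ (1 - q^-1).
  rewrite -[X in _ * X](powRr1 (ltW m0)) -!powRD ?(gt_eqF m0) ?implybT//.
  by congr (_ `^ _); ring.
set x := (X / m) `^ _; set y := (Y / m) `^ _.
set M := m `^ (p^-1 - q^-1) in mid0 Ale *.
have M0 : 0 < M by rewrite powR_gt0.
have x0 : 0 <= x by exact: powR_ge0.
have y0 : 0 <= y by exact: powR_ge0.
set wa := (m^-1 * W) `^ _ in Ale; set vb := (m^-1 * V) `^ _ in Ale.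
have wa0 : 0 <= wa by exact: powR_ge0.
have vb0 : 0 <= vb by exact: powR_ge0.
have gamle' : gam <= x * wa * m.
  apply: le_trans gamle _; rewrite (scale X)// (scale W)// [W / m]mulrC -/x -/wa.
  by rewrite mulrACA mD.
have nule' : nu <= vb * y * m.
  apply: le_trans nule _; rewrite (scale V)// (scale Y)// [V / m]mulrC -/y -/vb.
  by rewrite mulrACA mD.
apply: (@le_trans _ _ (side * (x * wa) * (vb * y * m))).
  have gm : gam / m <= x * wa by rewrite ler_pdivrMr.
  have sg0 : 0 <= side * (gam / m) by rewrite mulr_ge0// divr_ge0// ltW.
  apply: le_trans (ler_wpM2l sg0 nule') _.
  have vym0 : 0 <= vb * y * m by rewrite !mulr_ge0// ltW.
  by apply: ler_wpM2r => //; apply: ler_wpM2l.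
have -> : m `^ p^-1 * x * (m `^ (1 - q^-1) * y) = M * m * (x * y).
  by rewrite mid0; ring.
apply: (@le_trans _ _ (side / M * wa * vb * (M * m * (x * y)))).
  by rewrite le_eqVlt; apply/orP; left; apply/eqP; field; rewrite gt_eqF.
by rewrite ler_wpM2r// !mulr_ge0// ltW.
Qed.

Section exponents.
Context {R : realType}.
Implicit Types p q a b : R.

Lemma conj_exp_gt1 p : 1 < p -> 1 < conj_exp p.
Proof. by move=> p1; rewrite /conj_exp ltr_pdivlMr ?subr_gt0//; lra. Qed.

Lemma conj_exp_inv p : 1 < p -> (conj_exp p)^-1 = 1 - p^-1.
Proof. by move=> p1; rewrite /conj_exp; field; rewrite !gt_eqF//; lra. Qed.

Lemma conj_exp_lt p a : 1 < p -> 1 < a -> conj_exp p < a -> conj_exp a < p.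
Proof.
by move=> p1 a1; rewrite /conj_exp ltr_pdivrMr ?subr_gt0// ltr_pdivrMr ?subr_gt0//; lra.
Qed.

Lemma conj_expK p : 1 < p -> conj_exp (conj_exp p) = p.
Proof. by move=> p1; rewrite /conj_exp; field; rewrite !gt_eqF//; lra. Qed.

End exponents.

Section weighted_tree.
Context {R : realType} {n : nat}.
Local Notation mu := (lebesgue_rV R n).
Implicit Types (Q P : cube R n).

(** The bounds given by [A_class] hold on the dyadic subcubes of [Q] only, hence the nodes
    of the tree carry a proof of dyadicity. *)
Definition dyadic_node Q := {P : cube R n | dyadic Q P}.

Definition dyadic_root Q : dyadic_node Q := exist _ Q (dyadic_refl Q).

Definition node_child Q (x : dyadic_node Q) (e : {ffun 'I_n -> bool}) : dyadic_node Q :=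
  exist _ (child (sval x) e) (dyadic_child e (svalP x)).

Lemma node_subset Q (x : dyadic_node Q) : (sval x : set 'rV[R]_n) `<=` Q.
Proof. exact: dyadic_subset (svalP x). Qed.

Lemma lebesgue_measurable_cube Q : measurable (Q : set (lebesgue_type R n)).
Proof. exact: borel_lebesgue (measurable_cube n Q). Qed.

Lemma node_integrable Q (x : dyadic_node Q) (f : 'rV[R]_n -> R) :
  mu.-integrable Q (EFin \o f) -> mu.-integrable (sval x) (EFin \o f).
Proof.
apply: integrableS; [exact: lebesgue_measurable_cube..|exact: node_subset].
Qed.

Lemma node_mass Q (f : 'rV[R]_n -> R) : (forall x, 0 <= f x) ->
  mu.-integrable Q (EFin \o f) ->
  additive_mass (@node_child Q) (fun x => \int[mu]_(y in sval x) f y).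
Proof.
move=> f0 fi; split=> x; first by apply: Rintegral_ge0.
exact: Rintegral_children (node_integrable Q x f fi).
Qed.

Lemma fine_lebesgue_cube P : fine (mu P) = vol (P : set 'rV[R]_n).
Proof. by []. Qed.

Definition tree_cst (p q r : R) : R :=
  2 * (embedding_cst (p / conj_exp (conj_exp p * r)) +
       embedding_cst (conj_exp q / conj_exp (q * r))).

(** On a dyadic cube, Hölder's inequality is applied to [g = (w g) * w^-1] with exponents
    [s] and [a = p' r], and to [v h] with exponents [b = q r] and [t].  As [r > 1], the
    exponents [s = a'] and [t = b'] are smaller than [p] and [q'], so that Jensen's
    inequality provides the remaining hypotheses of [tree_bilinear]. *)
Lemma weighted_tree_bound (p q r : R) Q (w v g h : 'rV[R]_n -> R) (xi eta : R) k :
  1 < p -> 1 < q -> 1 < r -> p <= q -> A_class p q r r Q w v ->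
  measurable_fun (Q : set (lebesgue_type R n)) g ->
  measurable_fun (Q : set (lebesgue_type R n)) h ->
  (forall x, 0 <= g x) -> (forall x, 0 <= h x) ->
  mu.-integrable Q (EFin \o (fun x => (`|w x| * g x) `^ p)) ->
  mu.-integrable Q (EFin \o (fun x => h x `^ conj_exp q)) ->
  0 < xi -> 0 < eta ->
  \int[mu]_(x in Q) (`|w x| * g x) `^ p <= xi `^ p ->
  \int[mu]_(x in Q) h x `^ conj_exp q <= eta `^ conj_exp q ->
  [/\ mu.-integrable Q (EFin \o g),
      mu.-integrable Q (EFin \o (fun x => `|v x| * h x)) &
   tree_sum (@node_child Q) k (fun x => side (sval x) *
      (\int[mu]_(y in sval x) g y / vol (sval x : set 'rV[R]_n)) *
      \int[mu]_(y in sval x) (`|v y| * h y)) (dyadic_root Q) <=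
   tree_cst p q r * (fine (A_char p q r r Q w v) * xi * eta) ].
Proof.
move=> p1 q1 r1 pq Awv mg mh g0 h0 ig ih xi0 eta0 gxi heta.
have [p0 q0 r0] : [/\ 0 < p, 0 < q & 0 < r] by split; exact: lt_trans ltr01 _.
have p'1 := conj_exp_gt1 p p1; have q'1 := conj_exp_gt1 q q1.
pose a := conj_exp p * r; pose b := q * r.
have pa : conj_exp p < a by rewrite /a ltr_pMr// (lt_trans ltr01).
have qb : q < b by rewrite /b ltr_pMr.
have a1 : 1 < a := lt_trans p'1 pa; have b1 : 1 < b := lt_trans q1 qb.
have a0 : 0 < a := lt_trans ltr01 a1; have b0 : 0 < b := lt_trans ltr01 b1.
pose s := conj_exp a; pose t := conj_exp b.
have s1 : 1 < s := conj_exp_gt1 a a1; have t1 : 1 < t := conj_exp_gt1 b b1.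
have s0 : 0 < s := lt_trans ltr01 s1; have t0 : 0 < t := lt_trans ltr01 t1.
have sp : s < p by exact: conj_exp_lt.
have tq : t < conj_exp q by apply: conj_exp_lt => //; rewrite conj_expK.
have sa : s^-1 + a^-1 = 1 by rewrite conj_exp_inv//; ring.
have bt : b^-1 + t^-1 = 1 by rewrite conj_exp_inv//; ring.
have [Qw Qv _] := Awv.
have mQ := lebesgue_measurable_cube Q.
have mw := measurable_weight Q w Qw; have mv := measurable_weight Q v Qv.
have mwg := measurable_fun_normM _ (lebesgue_type R n) _ Q w g mw mg.
have wg0 x : 0 <= `|w x| * g x by rewrite mulr_ge0.
have iX : mu.-integrable Q (EFin \o (fun x => (`|w x| * g x) `^ s)).
  apply: (integrable_powR_le _ (lebesgue_type R n) _ mu Q mQ _ s p (lebesgue_cube_lty Q) mwg _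
    _ ig) => //.
  by rewrite (ltW s0) (ltW sp).
have iY : mu.-integrable Q (EFin \o (fun x => h x `^ t)).
  apply: (integrable_powR_le _ (lebesgue_type R n) _ mu Q mQ _ t _ (lebesgue_cube_lty Q) mh _ _
    ih) => //.
  by rewrite (ltW t0) (ltW tq).
(* Real powers of negative numbers are not the usual ones, and the weights are
   positive almost everywhere only: the inverse of [w] is written [w x `^ (- 1)], whose
   powers are those of the characteristic, and agrees with the true one almost
   everywhere. *)
have aew : {ae mu, forall x, (Q : set 'rV[R]_n) x -> `|w x| * g x * w x `^ (- 1) = g x}.
  case: Qw => _; apply: (@filterS _ _ (ae_filter_ringOfSetsType mu)) => x wx /wx[wx0 _].
  by rewrite gtr0_norm// powR_inv1 ?(ltW wx0)// mulrAC divff ?mul1r// gt_eqF.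
have aev : {ae mu, forall x, (Q : set 'rV[R]_n) x -> v x `^ 1 * h x = `|v x| * h x}.
  case: Qv => _; apply: (@filterS _ _ (ae_filter_ringOfSetsType mu)) => x vx /vx[vx0 _].
  by rewrite gtr0_norm// powRr1// ltW.
have local (x : dyadic_node Q) (P := sval x) :
  [/\ mu.-integrable P (EFin \o g), mu.-integrable P (EFin \o (fun x => `|v x| * h x)) &
   side P * (\int[mu]_(y in P) g y / vol (P : set 'rV[R]_n)) * \int[mu]_(y in P) (`|v y| * h y) <=
   fine (A_char p q r r Q w v) *
    ((vol (P : set 'rV[R]_n) `^ p^-1 *
        (\int[mu]_(y in P) (`|w y| * g y) `^ s / vol (P : set 'rV[R]_n)) `^ s^-1) *
     (vol (P : set 'rV[R]_n) `^ (conj_exp q)^-1 *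
        (\int[mu]_(y in P) h y `^ t / vol (P : set 'rV[R]_n)) `^ t^-1)) ].
  have PQ : (P : set 'rV[R]_n) `<=` Q := node_subset Q x.
  have mP := lebesgue_measurable_cube P.
  have restr (f : 'rV[R]_n -> R) : measurable_fun (Q : set (lebesgue_type R n)) f ->
    measurable_fun (P : set (lebesgue_type R n)) f by exact: measurable_funS.
  have aerestr (f1 f2 : 'rV[R]_n -> R) : {ae mu, forall x, (Q : set 'rV[R]_n) x -> f1 x = f2 x} ->
    {ae mu, forall x, (P : set 'rV[R]_n) x -> f1 x = f2 x}.
    by apply: (@filterS _ _ (ae_filter_ringOfSetsType mu)) => y fy /PQ.
  have [iw iv] := A_class_dyadic p q r r Q w v P p1 q0 r0 r0 Awv (svalP x).
  rewrite -/a -/b => Ale.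
  have iwa : mu.-integrable P (EFin \o (fun x => (w x `^ (- 1)) `^ a)).
    rewrite (_ : (fun x => (w x `^ (- 1)) `^ a) = (fun x => w x `^ (- a)))//.
    by apply/funext => y; rewrite -powRrM mulN1r.
  have ivb : mu.-integrable P (EFin \o (fun x => (v x `^ 1) `^ b)).
    rewrite (_ : (fun x => (v x `^ 1) `^ b) = (fun x => v x `^ b))//.
    by apply/funext => y; rewrite -powRrM mul1r.
  have mwP := measurable_fun_powR _ (lebesgue_type R n) _ P w (- 1) (restr _ mw).
  have mvP := measurable_fun_powR _ (lebesgue_type R n) _ P v 1 (restr _ mv).
  have [ig1 leg] := hoelder_Rintegral _ (lebesgue_type R n) _ mu P mP _ _ s a s0 a0 sa
    (restr _ mwg) mwP (fun y _ => wg0 y) (fun y _ => powR_ge0 _ _) (node_integrable Q x _ iX) iwa.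
  have [ih1 leh] := hoelder_Rintegral _ (lebesgue_type R n) _ mu P mP _ _ b t b0 t0 bt
    mvP (restr _ mh) (fun y _ => powR_ge0 _ _) (fun y _ => h0 y) ivb (node_integrable Q x _ iY).
  have mvh := restr _ (measurable_fun_normM _ (lebesgue_type R n) _ Q v h mv mh).
  have igP := ae_integrable _ (lebesgue_type R n) _ mu P mP _ _ (restr _ mg) (aerestr _ _ aew)
    ig1.
  have ihP := ae_integrable _ (lebesgue_type R n) _ mu P mP _ _ mvh (aerestr _ _ aev) ih1.
  split => //.
  have meas_int (f : 'rV[R]_n -> R) : mu.-integrable P (EFin \o f) ->
    measurable_fun (P : set (lebesgue_type R n)) f.
    by move=> /integrableP[/measurable_EFinP].
  rewrite (ae_eq_Rintegral _ (lebesgue_type R n) _ mu P mP _ _ (restr _ mg) (aerestr _ _ aew)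
    (meas_int _ ig1)) in leg.
  rewrite (ae_eq_Rintegral _ (lebesgue_type R n) _ mu P mP _ _ mvh (aerestr _ _ aev) (meas_int
    _ ih1)) in leh.
  have Ew : \int[mu]_(y in P) (w y `^ (- 1)) `^ a = \int[mu]_(y in P) w y `^ (- a).
    by apply: eq_Rintegral => y _; rewrite -powRrM mulN1r.
  have Ev : \int[mu]_(y in P) (v y `^ 1) `^ b = \int[mu]_(y in P) v y `^ b.
    by apply: eq_Rintegral => y _; rewrite -powRrM mul1r.
  rewrite conj_exp_inv//.
  apply: (@hoelder_key R _ _ _ _ _ _ _ _ _ p q a b s t _ _ _ _ _ _ _ _ sa bt leg leh).
  - exact: vol_gt0.
  - exact/ltW/side_gt0.
  - by apply: Rintegral_ge0.
  - by apply: Rintegral_ge0 => y _; exact: powR_ge0.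
  - by apply: Rintegral_ge0 => y _; exact: powR_ge0.
  - by apply: Rintegral_ge0 => y _; exact: powR_ge0.
  - by apply: Rintegral_ge0 => y _; exact: powR_ge0.
  - apply: le_trans Ale; rewrite !mulr_ge0 ?powR_ge0// ?invr_ge0 ?powR_ge0//.
    exact/ltW/side_gt0.
  - by rewrite Ew Ev.
have [ig1 ivh _] := local (dyadic_root Q).
split => //.
have jensen (f : 'rV[R]_n -> R) c c' (c0 : 0 < c) (cc' : c < c') (x : dyadic_node Q) :
    (forall y, 0 <= f y) -> mu.-integrable Q (EFin \o (fun y => f y `^ c)) ->
    mu.-integrable Q (EFin \o (fun y => f y `^ c')) ->
    vol (sval x : set 'rV[R]_n) * (\int[mu]_(y in sval x) f y `^ c /
       vol (sval x : set 'rV[R]_n)) `^ (c' / c) <= \int[mu]_(y in sval x) f y `^ c'.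
  move=> f0 fc fc'; have fE : (fun y => (f y `^ c) `^ (c' / c)) = (fun y => f y `^ c').
    by apply/funext => y; rewrite -powRrM mulrC divfK// gt_eqF.
  have jE : \int[mu]_(y in sval x) (f y `^ c) `^ (c' / c) = \int[mu]_(y in sval x) f y `^ c'.
    by apply: eq_Rintegral => y _; rewrite -powRrM mulrC divfK// gt_eqF.
  rewrite -jE; apply: (jensen_powR _ (lebesgue_type R n) _ mu _ (lebesgue_measurable_cube (sval
    x)) (fun y => f y `^ c)).
  - by rewrite ltr_pdivlMr// mul1r.
  - exact: vol_gt0.
  - exact: lebesgue_cube_lty.
  - by move=> y _; exact: powR_ge0.
  - exact: (node_integrable Q x (fun y => f y `^ c) fc).
  - by rewrite fE; exact: (node_integrable Q x (fun y => f y `^ c') fc').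
have A0 : 0 <= fine (A_char p q r r Q w v).
  have [_ _] := A_class_dyadic p q r r Q w v Q p1 q0 r0 r0 Awv (dyadic_refl Q).
  by apply: le_trans; rewrite !mulr_ge0 ?powR_ge0// ?invr_ge0 ?powR_ge0//; exact/ltW/side_gt0.
apply: (tree_bilinear (@node_child Q) (fun x : dyadic_node Q => vol (sval x : set 'rV[R]_n))
  (fun x : dyadic_node Q => \int[mu]_(y in sval x) g y) _ _ _ p q s t _ xi eta
  (fun x : dyadic_node Q => side (sval x))
  (fun x : dyadic_node Q => \int[mu]_(y in sval x) (`|v y| * h y))
  (fun x : dyadic_node Q => \int[mu]_(y in sval x) (`|w y| * g y) `^ s)
  (fun x : dyadic_node Q => \int[mu]_(y in sval x) h y `^ t)
  (fun x : dyadic_node Q => \int[mu]_(y in sval x) (`|w y| * g y) `^ p)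
  (fun x : dyadic_node Q => \int[mu]_(y in sval x) h y `^ conj_exp q)) => //.
- by move=> x; exact: vol_gt0.
- by move=> x; exact: vol_children.
- exact: node_mass.
- by rewrite s0.
- by rewrite t0.
- by move=> x; exact/ltW/side_gt0.
- by apply: node_mass => // x; rewrite mulr_ge0.
- by apply: node_mass => // x; exact: powR_ge0.
- by apply: node_mass => // x; exact: powR_ge0.
- by apply: node_mass => // x; exact: powR_ge0.
- by apply: node_mass => // x; exact: powR_ge0.
- by move=> x; exact: jensen.
- by move=> x; exact: jensen.
- by move=> x; have [_ _] := local x.
Qed.

End weighted_tree.

(** * Extension of Lipschitz functions and their gradient *)

Section lipschitz_extension.
Context {R : realType} {n : nat}.
Local Notation mu := (lebesgue_rV R n).
Local Notation mu0 := (product_lebesgue R n).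
Implicit Types (Q P : cube R n) (f : 'rV[R]_n -> R).

(** The projection of a point onto the cube, coordinate by coordinate. *)
Definition clamp Q (x : 'rV[R]_n) : 'rV[R]_n :=
  \row_i Num.max (corner Q ord0 i) (Num.min (x ord0 i) (corner Q ord0 i + side Q)).

Lemma clamp_in Q x : (Q : set 'rV[R]_n) (clamp Q x).
Proof.
move=> i; rewrite mxE; have := side_gt0 Q.
by rewrite ge_max le_max ge_min lexx lerDl => /ltW ->; rewrite lexx orbT.
Qed.

Lemma clamp_id Q x : (Q : set 'rV[R]_n) x -> clamp Q x = x.
Proof.
move=> Qx; apply/rowP => i; rewrite mxE; have /andP[cx xc] := Qx i.
by rewrite (min_idPl xc) (max_idPr cx).
Qed.

Lemma clamp_lipschitz Q x y : `|clamp Q x - clamp Q y| <= `|x - y|.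
Proof.
apply: rV_norm_le => // i; apply: (le_trans _ (rV_norm_ge n (x - y) i)); rewrite !mxE.
set c := corner Q ord0 i; set d := c + side Q; set a := x ord0 i; set b := y ord0 i.
have cd : c <= d by rewrite lerDl ltW// side_gt0.
clearbody c d a b.
wlog ab : a b / b <= a => [h|].
  by case/orP : (le_total b a) => [/h//|/h]; rewrite distrC [leRHS]distrC.
rewrite [leRHS]ger0_norm ?subr_ge0// ler_norml /Num.max /Num.min.
by case: (ltP a d) => ?; case: (ltP b d) => ?; do 2 case: ltP => ?; apply/andP; split; lra.
Qed.

Lemma cube_dist Q x y : (Q : set 'rV[R]_n) x -> (Q : set 'rV[R]_n) y -> `|x - y| <= side Q.
Proof.
move=> Qx Qy; apply: rV_norm_le => [|i]; first exact/ltW/side_gt0.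
by rewrite !mxE ler_norml; have /andP[? ?] := Qx i; have /andP[? ?] := Qy i; apply/andP; split;
  lra.
Qed.

(** Compose [f] with the projection onto the cube, which does not increase distances. *)
Lemma lipschitz_extension Q f : [lipschitz f x | x in (Q : set 'rV[R]_n)] ->
  exists F K B, [/\ 0 < K, forall x y, `|F x - F y| <= K * `|x - y|,
    forall x, `|F x| <= B & forall x, (Q : set 'rV[R]_n) x -> F x = f x].
Proof.
move=> /pinfty_ex_gt0[K K0 lipf].
have lipQ x y : (Q : set 'rV[R]_n) x -> (Q : set 'rV[R]_n) y -> `|f x - f y| <= K * `|x - y|.
  by move=> Qx Qy; exact: (lipf (x, y)).
exists (f \o clamp Q), K, (`|f (corner Q)| + K * side Q); split => //=.
- move=> x y; apply: le_trans (lipQ _ _ (clamp_in Q x) (clamp_in Q y)) _.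
  by rewrite ler_pM2l// clamp_lipschitz.
- move=> x; have Qc : (Q : set 'rV[R]_n) (corner Q).
    by move=> i; rewrite lexx lerDl ltW// side_gt0.
  rewrite -[f (clamp Q x)](subrK (f (corner Q))) addrC.
  apply: le_trans (ler_normD _ _) _; rewrite lerD2l.
  apply: le_trans (lipQ _ _ (clamp_in Q x) Qc) _.
  by rewrite ler_pM2l// cube_dist//; exact: clamp_in.
- by move=> x Qx; rewrite clamp_id.
Qed.

Lemma ae_forall_ord (m : nat) (H : 'I_m -> 'rV[R]_n -> Prop) :
  (forall i, {ae mu, forall x, H i x}) -> {ae mu, forall x, forall i, H i x}.
Proof.
move=> aeH.
exact: (@filter_forall _ _ H _ (ae_filter_ringOfSetsType mu) aeH).
Qed.

Lemma ae_borel_null (N : set 'rV[R]_n) : measurable N -> mu0 N = 0%E ->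
  {ae mu, forall x, ~ N x}.
Proof.
move=> mN N0; exists N; split; [exact: borel_lebesgue| |by move=> x /= /contrapT].
by apply: etrans N0; exact: lebesgue_rVE.
Qed.

Lemma ae_interior_cube Q :
  {ae mu, forall x, (Q : set 'rV[R]_n) x -> forall i,
    corner Q ord0 i < x ord0 i < corner Q ord0 i + side Q}.
Proof.
have faces (c : 'I_n -> R) : {ae mu, forall x : 'rV[R]_n, forall i, x ord0 i <> c i}.
  apply: ae_forall_ord => i; have [mH H0] := hyperplane_null n i (c i).
  exact: ae_borel_null mH H0.
have both := @filterI _ _ (ae_filter_ringOfSetsType mu) _ _
  (faces (fun i => corner Q ord0 i)) (faces (fun i => corner Q ord0 i + side Q)).
apply: (@filterS _ _ (ae_filter_ringOfSetsType mu)) both => x [h1 h2] Qx i.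
have /andP[? ?] := Qx i; rewrite !lt_neqAle; apply/andP; split; apply/andP; split => //.
  by apply/eqP => /esym; exact: h1.
by apply/eqP; exact: h2.
Qed.

Lemma interior_cube_nbhs Q (x : 'rV[R]_n) :
  (forall i, corner Q ord0 i < x ord0 i < corner Q ord0 i + side Q) ->
  \forall y \near x, (Q : set 'rV[R]_n) y.
Proof.
move=> Qx.
exists (fun _ i => `]corner Q ord0 i, corner Q ord0 i + side Q[%classic) => /=.
  move=> i j; apply: open_nbhs_nbhs; split; first exact: interval_open.
  by rewrite /= in_itv/= (ord1 i); exact: Qx.
by move=> y yQ i; have := yQ ord0 i; rewrite /= in_itv/= => /andP[/ltW -> /ltW ->].
Qed.

(** Almost every point of the cube is interior, so that [f] and [F] have the same
    derivatives there, and [F] is almost everywhere derivable along the axes. *)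
Lemma ae_grad Q f F K : 0 < K -> (forall x y, `|F x - F y| <= K * `|x - y|) ->
  (forall x, (Q : set 'rV[R]_n) x -> F x = f x) ->
  {ae mu, forall x, (Q : set 'rV[R]_n) x -> grad f x = grad_part F x}.
Proof.
move=> K0 FK Ff.
have aeder : {ae mu, forall x, forall i : 'I_n, derivable F x (delta_mx ord0 i)}.
  apply: ae_forall_ord => i.
  have mN := measurable_nonderivable F K (delta_mx ord0 i) K0 FK.
  have N0 := nonderivable_null F K (delta_mx ord0 i) K0 FK (unitv_norm i).
  apply: (@filterS _ _ (ae_filter_ringOfSetsType mu)) (ae_borel_null _ mN N0) => x.
  exact: contrapT.
have both := @filterI _ _ (ae_filter_ringOfSetsType mu) _ _ aeder (ae_interior_cube Q).
apply: (@filterS _ _ (ae_filter_ringOfSetsType mu)) both => x [dx intx] /intx Qx.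
apply/rowP => i; rewrite !mxE derivable_partE//; apply/esym.
apply: near_eq_derive.
by apply: filterS (interior_cube_nbhs Q x Qx); exact: Ff.
Qed.

End lipschitz_extension.

(** * Telescoping of the oscillation *)

Lemma integrable_bounded_mul d (T : measurableType d) (R : realType)
    (mu : {measure set T -> \bar R}) (D : set T) (f u : T -> R) (c : R) :
  measurable D -> measurable_fun D f ->
  (forall x, D x -> `|f x| <= c) -> (forall x, 0 <= u x) -> mu.-integrable D (EFin \o u) ->
  mu.-integrable D (EFin \o (fun x => f x * u x)).
Proof.
move=> mD mf fc u0 iu.
have mu_ : measurable_fun D u by move/integrableP : iu => [/measurable_EFinP].
apply: (integrable_dominated _ _ _ _ _ mD _ (fun x => c * u x)).
- exact: measurable_funM.
- by move=> x Dx; rewrite normrM (ger0_norm (u0 x)) ler_wpM2r ?fc.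
- exact: integrableZr_real.
Qed.

Lemma measurable_fun_dist d (T : measurableType d) (R : realType) (D : set T)
    (f : T -> R) (c : R) :
  measurable_fun D f -> measurable_fun D (fun x => `|f x - c|).
Proof.
by move=> mf; apply: measurableT_comp => //; apply: measurable_funB.
Qed.

Section oscillation.
Context {R : realType} {n : nat}.
Local Notation mu := (lebesgue_rV R n).
Variables (Q : cube R n) (F : 'rV[R]_n -> R) (K B : R).
Hypothesis K0 : 0 < K.
Hypothesis FK : forall x y, `|F x - F y| <= K * `|x - y|.
Hypothesis FB : forall x, `|F x| <= B.

Lemma lipschitz_integrable (P : cube R n) : mu.-integrable P (EFin \o F).
Proof.
apply: (bounded_integrable _ _ B) => //; [exact: measurable_cube|exact: lebesgue_cube_lty|].
exact: (continuous_measurable_rV n F (lipschitz_continuous F K K0 FK)).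
Qed.

Lemma lipschitz_measurable (P : cube R n) : measurable_fun (P : set (lebesgue_type R n)) F.
Proof. by have /integrableP[/measurable_EFinP] := lipschitz_integrable P. Qed.

Lemma cube_average_dist (P : cube R n) x : (P : set 'rV[R]_n) x ->
  `|F x - cube_average F P| <= K * side P.
Proof.
move=> Px; have vP := vol_gt0 n P.
have mP := lebesgue_measurable_cube P.
have ic (c : R) : mu.-integrable P (EFin \o (fun=> c)).
  apply: (bounded_integrable _ _ `|c|) => //; [exact: measurable_cube|exact: lebesgue_cube_lty].
have iFc : mu.-integrable P (EFin \o (fun y => F x - F y)).
  exact: (integrableB mP (ic (F x)) (lipschitz_integrable P)).
have -> : F x - cube_average F P = (vol (P : set 'rV[R]_n))^-1 * \int[mu]_(y in P) (F x - F y).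
  rewrite (RintegralB mP (ic (F x)) (lipschitz_integrable P)) (Rintegral_cst _ mP) /cube_average.
  rewrite fine_lebesgue_cube.
  by rewrite mulrBr mulrCA mulVf ?mulr1// gt_eqF.
rewrite normrM gtr0_norm ?invr_gt0// mulrC ler_pdivrMr//.
apply: le_trans (le_normr_Rintegral mP iFc) _.
apply: (@le_trans _ _ (\int[mu]_(y in P) (K * side P))).
  apply: (le_Rintegral mP); [exact: (integrable_norm iFc)|exact: ic|].
  move=> y Py; apply: le_trans (FK _ _) _; rewrite ler_pM2l//.
  exact: cube_dist.
by rewrite (Rintegral_cst _ mP) fine_lebesgue_cube.
Qed.

Variable u : 'rV[R]_n -> R.
Hypothesis u0 : forall x, 0 <= u x.
Hypothesis iu : mu.-integrable Q (EFin \o u).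

(** Replacing, on a child, the average over the parent by the one over the child costs
    [child_average_le]; after [k] generations what is left is the oscillation on cubes
    of side [side / 2 ^+ k], estimated by the Lipschitz constant. *)
Lemma oscillation_tree_sum k (x : dyadic_node Q) :
  \int[mu]_(y in sval x) (`|F y - cube_average F (sval x)| * u y) <=
  poincare_cst (n := n) * tree_sum (@node_child R n Q) k (fun x => side (sval x) *
      (\int[mu]_(y in sval x) enorm (grad_part F y) / vol (sval x : set 'rV[R]_n)) *
      \int[mu]_(y in sval x) u y) x +
  K * side (sval x) / 2 ^+ k * \int[mu]_(y in sval x) u y.
Proof.
have iosc (x' : dyadic_node Q) (c : R) :
    mu.-integrable (sval x') (EFin \o (fun y => `|F y - c| * u y)).
  apply: (integrable_bounded_mul _ (lebesgue_type R n) _ mu _ _ _ (B + `|c|)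
    (lebesgue_measurable_cube _) _ _ u0
    (node_integrable Q x' u iu)).
  - exact: (measurable_fun_dist _ (lebesgue_type R n) _ _ F c (lipschitz_measurable (sval x'))).
  - by move=> y _; rewrite normr_id (le_trans (ler_normB _ _))// lerD2r.
elim: k x => [|k IH] x.
  rewrite /= mulr0 add0r expr0 divr1.
  rewrite -(RintegralZl (K * side (sval x)) (lebesgue_measurable_cube (sval x))
    (node_integrable Q x u iu)).
  apply: (le_Rintegral (lebesgue_measurable_cube (sval x))); first exact: iosc.
    exact: (integrableZr_real _ (lebesgue_type R n) _ mu _ (lebesgue_measurable_cube (sval x))
      _ u (node_integrable Q x u iu)).
  by move=> y Py; rewrite ler_wpM2r// cube_average_dist.
set P := sval x.
have massu := node_mass Q u u0 iu.
pose gP := \int[mu]_(y in P) enorm (grad_part F y) / vol (P : set 'rV[R]_n).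
rewrite (Rintegral_children n P _ (iosc x _)).
have step (e : {ffun 'I_n -> bool}) :
  \int[mu]_(y in child P e) (`|F y - cube_average F P| * u y) <=
  poincare_cst (n := n) * tree_sum (@node_child R n Q) k (fun x => side (sval x) *
      (\int[mu]_(y in sval x) enorm (grad_part F y) / vol (sval x : set 'rV[R]_n)) *
      \int[mu]_(y in sval x) u y) (node_child Q x e) +
  K * (side P / 2) / 2 ^+ k * \int[mu]_(y in child P e) u y +
  poincare_cst (n := n) * (side P * gP) * \int[mu]_(y in child P e) u y.
  have mC := lebesgue_measurable_cube (child P e).
  have iuC : mu.-integrable (child P e) (EFin \o u) := node_integrable Q (node_child Q x e) u iu.
  have iC c : mu.-integrable (child P e) (EFin \o (fun y => `|F y - c| * u y)) :=
    iosc (node_child Q x e) c.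
  pose dlt := `|cube_average F (child P e) - cube_average F P|.
  have iD : mu.-integrable (child P e) (EFin \o (fun y => dlt * u y)).
    exact: (integrableZr_real _ (lebesgue_type R n) _ mu _ mC _ u iuC).
  apply: (@le_trans _ _ (\int[mu]_(y in child P e)
     (`|F y - cube_average F (child P e)| * u y + dlt * u y))).
    apply: (le_Rintegral mC (iC _)).
      exact: (integrableDr _ (lebesgue_type R n) _ mu _ mC _ _ (iC _) iD).
    move=> y _; rewrite -mulrDl ler_wpM2r//; exact: ler_distD.
  rewrite (RintegralD mC (iC _) iD) (RintegralZl _ mC iuC).
  apply: lerD; first exact: (IH (node_child Q x e)).
  rewrite ler_wpM2r//; first exact: Rintegral_ge0.
  exact: (child_average_le F K B K0 FK FB P e).
apply: le_trans (ler_sum _ (fun e _ => step e)) _.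
rewrite !big_split/= -!mulr_sumr -[\sum_(e : {ffun 'I_n -> bool})
  \int[mu]_(y in child P e) u y](massu.2 x) -/P -/gP.
rewrite le_eqVlt; apply/orP; left; apply/eqP.
rewrite exprS; field.
by rewrite expf_neq0// pnatr_eq0.
Qed.

End oscillation.

(** * The inequality for bounded Lipschitz functions on the whole space *)

Lemma ler_geometric_limit {R : realType} (x y c : R) : 0 <= c ->
  (forall k : nat, x <= y + c / 2 ^+ k) -> x <= y.
Proof.
move=> c0 H; apply/ler_addgt0Pr => e e0.
apply: le_trans (H (Num.bound (c / e))) _; rewrite lerD2l ler_pdivrMr ?exprn_gt0//.
rewrite mulrC -ler_pdivrMr//; apply: le_trans (ltW (archi_boundP (divr_ge0 c0 (ltW e0)))) _.
by rewrite -natrX ler_nat ltnW// ltn_expl.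
Qed.

Lemma measurable_fun_norm d (T : measurableType d) (R : realType) (D : set T) (f : T -> R) :
  measurable_fun D f -> measurable_fun D (fun x => `|f x|).
Proof. by move=> mf; exact: measurableT_comp. Qed.

Lemma embedding_cst_ge0 {R : realType} (P : R) : 1 < P -> 0 <= embedding_cst P.
Proof. by move=> P1; rewrite divr_ge0 ?powR_ge0// subr_ge0 ltW. Qed.

Lemma tree_cst_ge0 {R : realType} (p q r : R) : 1 < p -> 1 < q -> 1 < r -> 0 <= tree_cst p q r.
Proof.
move=> p1 q1 r1.
have p'1 := conj_exp_gt1 p p1; have q'1 := conj_exp_gt1 q q1.
have pa : conj_exp p < conj_exp p * r by rewrite ltr_pMr// (lt_trans ltr01).
have qb : q < q * r by rewrite ltr_pMr// (lt_trans ltr01).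
have a1 := lt_trans p'1 pa; have b1 := lt_trans q1 qb.
have s1 := conj_exp_gt1 _ a1; have t1 := conj_exp_gt1 _ b1.
rewrite /tree_cst mulr_ge0// addr_ge0// embedding_cst_ge0//.
  by rewrite ltr_pdivlMr ?(lt_trans ltr01)// mul1r conj_exp_lt.
by rewrite ltr_pdivlMr ?(lt_trans ltr01)// mul1r conj_exp_lt// conj_expK.
Qed.

Section main.
Context {R : realType} {n : nat}.
Local Notation mu := (lebesgue_rV R n).
Variables (p q r : R) (Q : cube R n) (w v F : 'rV[R]_n -> R) (K B : R).
Hypotheses (p1 : 1 < p) (q1 : 1 < q) (r1 : 1 < r) (pq : p <= q).
Hypothesis Awv : A_class p q r r Q w v.
Hypothesis K0 : 0 < K.
Hypothesis FK : forall x y, `|F x - F y| <= K * `|x - y|.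
Hypothesis FB : forall x, `|F x| <= B.

Let z x := `|F x - cube_average F Q|.
Let g x := enorm (grad_part F x).

Lemma weight_powR_integrable : mu.-integrable Q (EFin \o (fun x => `|v x| `^ q)).
Proof.
have q0 := lt_trans ltr01 q1; have r0 := lt_trans ltr01 r1.
have [_ Qv _] := Awv; have mQ := lebesgue_measurable_cube Q.
have mv := measurable_fun_norm _ (lebesgue_type R n) _ Q v (measurable_weight Q v Qv).
have [_ iv _] := A_class_dyadic p q r r Q w v Q p1 q0 r0 r0 Awv (dyadic_refl Q).
have iv' : mu.-integrable Q (EFin \o (fun x => `|v x| `^ (q * r))).
  apply: (ae_integrable _ (lebesgue_type R n) _ mu Q mQ _ _
    (measurable_fun_powR _ (lebesgue_type R n) _ Q _ (q * r) mv) _ iv).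
  case: Qv => _; apply: (@filterS _ _ (ae_filter_ringOfSetsType mu)) => x vx /vx[vx0 _].
  by rewrite gtr0_norm.
apply: (integrable_powR_le _ (lebesgue_type R n) _ mu Q mQ _ q _ (lebesgue_cube_lty Q) mv _ _
  iv').
  by [].
by rewrite (ltW q0) ler_pMr// ltW.
Qed.

Let z0 x : 0 <= z x. Proof. exact: normr_ge0. Qed.

Let mz : measurable_fun (Q : set (lebesgue_type R n)) z.
Proof.
exact: (measurable_fun_dist _ (lebesgue_type R n) _ Q F _ (lipschitz_measurable F K B K0 FK FB
  Q)).
Qed.

Let mvz : measurable_fun (Q : set (lebesgue_type R n)) (fun x => `|v x| * z x).
Proof.
have [_ Qv _] := Awv.
exact: (measurable_fun_normM _ (lebesgue_type R n) _ Q v z (measurable_weight Q v Qv) mz).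
Qed.

(** That the norm to be estimated is finite beforehand is what allows the duality argument
    to divide by a power of it. *)
Lemma weighted_oscillation_integrable : mu.-integrable Q (EFin \o (fun x => (`|v x| * z x) `^ q)).
Proof.
have mQ := lebesgue_measurable_cube Q; have q0 := lt_trans ltr01 q1.
apply: (integrable_dominated _ (lebesgue_type R n) _ mu Q mQ _
  (fun x => (K * side Q) `^ q * `|v x| `^ q)
  (measurable_fun_powR _ (lebesgue_type R n) _ Q _ q mvz)).
  move=> x Qx; have Ks0 : 0 <= K * side Q by rewrite mulr_ge0 ?(ltW K0) ?(ltW (side_gt0 Q)).
  rewrite ger0_norm ?powR_ge0// -powRM//.
  apply: (ge0_ler_powR (ltW q0)); [by rewrite nnegrE mulr_ge0 ?z0|by rewrite nnegrE mulr_ge0|].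
  rewrite mulrC; apply: ler_wpM2r => //.
  exact: (cube_average_dist F K B K0 FK FB Q x Qx).
exact: (integrableZr_real _ (lebesgue_type R n) _ mu Q mQ _ _ weight_powR_integrable).
Qed.

(** Duality: [L] is the integral of [z] against [`|v| * h] with
    [h = (`|v| * z) `^ (q - 1)], and the L^q' norm of [h] is [L `^ (1 / q')].  The bound
    of the tree sum reads [L <= C * L `^ (1 / q') * X `^ p^-1], and it remains to divide. *)
Lemma weighted_poincare :
  mu.-integrable Q (EFin \o (fun x => (`|w x| * g x) `^ p)) ->
  (\int[mu]_(x in Q) (`|v x| * z x) `^ q) `^ q^-1 <=
  poincare_cst (n := n) * tree_cst p q r * fine (A_char p q r r Q w v) *
  (\int[mu]_(x in Q) (`|w x| * g x) `^ p) `^ p^-1.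
Proof.
move=> ig; have mQ := lebesgue_measurable_cube Q.
have p0 := lt_trans ltr01 p1; have q0 := lt_trans ltr01 q1; have r0 := lt_trans ltr01 r1.
have q10 : 0 < q - 1 by rewrite subr_gt0.
have q'1 := conj_exp_gt1 q q1.
have q'0 : 0 < conj_exp q := lt_trans ltr01 q'1.
have [L LE] : exists L, L = \int[mu]_(x in Q) (`|v x| * z x) `^ q by eexists.
have [X XE] : exists X, X = \int[mu]_(x in Q) (`|w x| * g x) `^ p by eexists.
rewrite -LE -XE.
have L0 : 0 <= L by rewrite LE; apply: Rintegral_ge0 => x _; exact: powR_ge0.
have X0 : 0 <= X by rewrite XE; apply: Rintegral_ge0 => x _; exact: powR_ge0.
have [A AE] : exists A, A = fine (A_char p q r r Q w v) by eexists.
have A0 : 0 <= A.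
  rewrite AE; have [_ _] := A_class_dyadic p q r r Q w v Q p1 q0 r0 r0 Awv (dyadic_refl Q).
  by apply: le_trans; rewrite !mulr_ge0 ?powR_ge0// ?invr_ge0 ?powR_ge0//; exact/ltW/side_gt0.
rewrite -AE.
have Cn0 : 0 <= poincare_cst (R := R) (n := n).
  by rewrite /poincare_cst mulr_ge0// divr_ge0// exprn_ge0.
have Ct0 := tree_cst_ge0 p q r p1 q1 r1.
have [L_eq0|L_neq0] := eqVneq L 0.
  rewrite L_eq0 powR0 ?invr_eq0 ?gt_eqF//.
  exact: mulr_ge0 (mulr_ge0 (mulr_ge0 Cn0 Ct0) A0) (powR_ge0 _ _).
have Lp : 0 < L by rewrite lt_neqAle eq_sym L_neq0.
pose h x := (`|v x| * z x) `^ (q - 1).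
have vz0 x : 0 <= `|v x| * z x by rewrite mulr_ge0 ?z0.
have mh := measurable_fun_powR _ (lebesgue_type R n) _ Q _ (q - 1) mvz.
have h0 x : 0 <= h x by exact: powR_ge0.
have hq x : h x `^ conj_exp q = (`|v x| * z x) `^ q.
  by rewrite -powRrM /conj_exp mulrCA divff ?mulr1// gt_eqF.
have ih : mu.-integrable Q (EFin \o (fun x => h x `^ conj_exp q)).
  rewrite (_ : (fun x => h x `^ conj_exp q) = (fun x => (`|v x| * z x) `^ q)); last exact/funext.
  exact: weighted_oscillation_integrable.
have g0 x : 0 <= g x by exact: sqrtr_ge0.
have mg : measurable_fun (Q : set (lebesgue_type R n)) g.
  by have /integrableP[/measurable_EFinP] := grad_part_integrable F K K0 FK Q.
have [eta etaE] : exists eta, eta = L `^ (conj_exp q)^-1 by eexists.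
have eta0 : 0 < eta by rewrite etaE powR_gt0.
have hle : \int[mu]_(x in Q) h x `^ conj_exp q <= eta `^ conj_exp q.
  rewrite etaE powR_rootK// LE le_eqVlt; apply/orP; left; apply/eqP.
  by apply: eq_Rintegral => x _; rewrite hq.
(* The shift by [e] keeps the normalising constant [xi] of the tree bound positive. *)
have bound e : 0 < e -> L <= poincare_cst (n := n) * tree_cst p q r * A * eta * (X `^ p^-1 + e).
  move=> e0.
  have xi0 : 0 < X `^ p^-1 + e by rewrite ltr_wpDl ?powR_ge0.
  have gle : \int[mu]_(x in Q) (`|w x| * g x) `^ p <= (X `^ p^-1 + e) `^ p.
    rewrite -XE -[leLHS](powR_rootK _ X p X0 p0).
    apply: (ge0_ler_powR (ltW p0)); rewrite ?nnegrE ?powR_ge0 ?(ltW xi0)//.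
    by rewrite lerDl ltW.
  have tree k := weighted_tree_bound p q r Q w v g h (X `^ p^-1 + e) eta k
     p1 q1 r1 pq Awv mg mh g0 h0 ig ih xi0 eta0 gle hle.
  have [_ iu _] := tree 0%N.
  have u0 x : 0 <= `|v x| * h x by rewrite mulr_ge0.
  have U0 : 0 <= \int[mu]_(y in Q) (`|v y| * h y) by apply: Rintegral_ge0.
  apply: (@ler_geometric_limit _ _ _ (K * side Q * \int[mu]_(y in Q) (`|v y| * h y))).
    by rewrite !mulr_ge0 ?(ltW K0) ?(ltW (side_gt0 Q)).
  move=> k; have [_ _ treek] := tree k.
  have osc := oscillation_tree_sum Q F K B K0 FK FB (fun x =>
    `|v x| * h x) u0 iu k (dyadic_root Q).
  have -> : L = \int[mu]_(y in Q) (z y * (`|v y| * h y)).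
    rewrite LE; apply: eq_Rintegral => y _.
    by rewrite mulrA [z y * _]mulrC mulr_powRB1.
  apply: le_trans osc _; apply: le_trans (lerD (ler_wpM2l Cn0 treek) (lexx _)) _.
  rewrite -AE /=; move: (\int[mu]_(y in Q) _) => U.
  by rewrite le_eqVlt; apply/orP; left; apply/eqP; ring.
have Lle : L <= poincare_cst (n := n) * tree_cst p q r * A * eta * X `^ p^-1.
  apply: ler_mul_limit; [|exact: powR_ge0|].
    exact: mulr_ge0 (mulr_ge0 (mulr_ge0 Cn0 Ct0) A0) (ltW eta0).
  move=> e e0; apply: le_trans (bound e e0) _.
  rewrite ler_wpM2r ?addr_ge0 ?powR_ge0 ?(ltW e0)//.
  by rewrite lerDl ltW.
rewrite -(ler_pM2r eta0).
have -> : L `^ q^-1 * eta = L.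
  rewrite etaE -powRD ?conj_exp_inv//; last by rewrite L_neq0 implybT.
  by rewrite addrC subrK powRr1.
by rewrite [leRHS]mulrAC.
Qed.

End main.

(** * The weighted inequality on a cube *)

Section norms.
Context {R : realType} {n : nat}.
Local Notation mu := (lebesgue_rV R n).
Implicit Types (Q : cube R n).

Lemma A_char_gt0 (p q r s : R) Q w v : is_weight Q w -> is_weight Q v ->
  (0 < A_char p q r s Q w v)%E.
Proof.
move=> Qw Qv.
apply: (lt_le_trans _ (ereal_sup_ubound (ex_intro2 _ _ Q (dyadic_refl Q) erefl))).
apply: mule_gt0; last first.
  by apply: poweR_gt0; exact: (weight_powR_gt0 Q v Q _ Qv (fun x h => h)).
apply: mule_gt0; last first.
  by apply: poweR_gt0; exact: (weight_powR_gt0 Q w Q _ Qw (fun x h => h)).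
by rewrite lte_fin divr_gt0 ?side_gt0 ?powR_gt0 ?vol_gt0.
Qed.

Lemma Lnorm_onE (E : set 'rV[R]_n) (p : R) (f : 'rV[R]_n -> R) : 0 < p ->
  Lnorm_on E p f = ((\int[mu]_(x in E) (`|f x| `^ p)%:E) `^ p^-1)%E.
Proof.
move=> p0; rewrite /Lnorm_on unlock [in RHS]integral_mkcond; congr (_ `^ _)%E.
apply: eq_integral => x _; rewrite !patchE; case: ifPn => _ //=.
by rewrite normr0 powR0// gt_eqF.
Qed.

Lemma fine_avg Q (f F : 'rV[R]_n -> R) : (forall x, (Q : set 'rV[R]_n) x -> F x = f x) ->
  mu.-integrable Q (EFin \o F) -> fine (avg Q (EFin \o f)) = cube_average F Q.
Proof.
move=> Ff iF; have E : (\int[mu]_(x in Q) (EFin \o f) x = \int[mu]_(x in Q) (EFin \o F) x)%E.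
  by apply: eq_integral => x; rewrite inE => /Ff /= ->.
have Ffin := integrable_fin_num (lebesgue_measurable_cube Q) iF.
by rewrite /avg E fineM.
Qed.

Lemma lebesgue_rV_complete : measure_is_complete mu.
Proof. exact: measure_is_complete_caratheodory. Qed.

End norms.

Theorem theorem3p1 (R : realType) (n : nat) (p q r : R) :
  (0 < n)%N -> 1 < p -> 1 < q -> 1 < r -> p <= q ->
  exists2 C : R, 0 < C &
    forall (Q : cube R n) (w v f : 'rV[R]_n -> R),
      A_class p q r r Q w v ->
      [lipschitz f x | x in (Q : set 'rV[R]_n)] ->
      (Lnorm_on Q q (fun x => (v x * (f x - fine (avg Q (EFin \o f))))%R)
       <= C%:E * A_char p q r r Q w v
          * Lnorm_on Q p (fun x => (w x * enorm (grad f x))%R))%E.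
Proof.
move=> _ p1 q1 r1 pq.
have p0 := lt_trans ltr01 p1; have q0 := lt_trans ltr01 q1; have r0 := lt_trans ltr01 r1.
set C0 : R := poincare_cst (n := n) * tree_cst p q r.
exists (`|C0| + 1); first by rewrite ltr_wpDl.
move=> Q w v f Awv lipf.
have [F [K [B [K0 FK FB Ff]]]] := lipschitz_extension Q f lipf.
have [Qw Qv Aoo] := Awv.
have A0 := A_char_gt0 p q r r Q w v Qw Qv.
have Af : A_char p q r r Q w v \is a fin_num by rewrite ge0_fin_numE// ltW.
have iF := lipschitz_integrable F K B K0 FK FB Q.
rewrite (fine_avg Q f F Ff iF) !Lnorm_onE//.
set g := fun x => enorm (grad_part F x).
have -> : (\int[lebesgue_rV R n]_(x in Q) (`|v x * (f x - cube_average F Q)| `^ q)%:E =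
   \int[lebesgue_rV R n]_(x in Q) ((`|v x| * `|F x - cube_average F Q|) `^ q)%:E)%E.
  by apply: eq_integral => x; rewrite inE => /Ff <-; rewrite normrM.
have mQ := lebesgue_measurable_cube Q.
have mg : measurable_fun (Q : set (lebesgue_type R n)) g.
  by have /integrableP[/measurable_EFinP] := grad_part_integrable F K K0 FK Q.
have mwg : measurable_fun (Q : set (lebesgue_type R n)) (fun x => (`|w x| * g x) `^ p).
  apply: (measurable_fun_powR _ (lebesgue_type R n)).
  exact: (measurable_fun_normM _ (lebesgue_type R n) _ Q w g (measurable_weight Q w Qw) mg).
have mwg' := (measurable_EFinP _ _).2 mwg.
(* The gradient of [f] is known almost everywhere only; completeness of the measure
   makes it measurable. *)
have aeg : ae_eq (lebesgue_rV R n) (Q : set 'rV[R]_n) (fun x => ((`|w x| * g x) `^ p)%:E)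
    (fun x => (`|w x * enorm (grad f x)| `^ p)%:E).
  have gradE := ae_grad Q f F K K0 FK Ff.
  apply: (@filterS _ _ (ae_filter_ringOfSetsType (lebesgue_rV R n))) gradE.
  by move=> x gE Qx; rewrite gE// normrM [`|enorm _|]ger0_norm// sqrtr_ge0.
have mwf := ae_measurable_fun lebesgue_rV_complete aeg mwg'.
rewrite -(ae_eq_integral _ _ mQ mwg' mwf aeg).
set X := (\int[lebesgue_rV R n]_(x in Q) ((`|w x| * g x) `^ p)%:E)%E.
have X0 : (0 <= X)%E by apply: integral_ge0 => x _; rewrite lee_fin powR_ge0.
have Cp : 0 < `|C0| + 1 by rewrite ltr_wpDl.
have [Xfin|] := boolP (X \is a fin_num); last first.
  rewrite ge0_fin_numE// -leNgt leye_eq => /eqP ->.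
  rewrite poweRyr ?invr_eq0 ?gt_eqF// gt0_muley ?leey//.
  by rewrite mule_gt0// lte_fin.
have iX : (lebesgue_rV R n).-integrable Q (EFin \o (fun x => (`|w x| * g x) `^ p)).
  apply/integrableP; split=> //.
  under eq_integral => x _ do rewrite /= ger0_norm ?powR_ge0//.
  by rewrite -ge0_fin_numE.
have main := weighted_poincare p q r Q w v F K B p1 q1 r1 pq Awv K0 FK FB iX.
have iL := weighted_oscillation_integrable p q r Q w v F K B p1 q1 r1 Awv K0 FK FB.
have Lfin := integrable_fin_num mQ iL.
rewrite -(fineK Xfin) -[X in (X `^ _ <= _)%E](fineK Lfin) -(fineK Af) !poweR_EFin -!EFinM lee_fin.
apply: le_trans main _.
rewrite ler_wpM2r ?powR_ge0// ler_wpM2r ?fine_ge0 ?(ltW A0)//.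
by rewrite (le_trans (ler_norm _))// lerDl.
Qed.
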